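(* Let $n\ge 1$, let $\lambda=(\lambda_1,\ldots,\lambda_{n+1})$ be a dominant weight of $G=GL(n+1)$ and let $\mu=(\mu_1,\ldots,\mu_n)$ be a dominant weight of $H=GL(n)$. Let $m(\lambda,\mu)$ be the multiplicity of the irreducible representation $\pi_\mu$ of $H$ with highest weight $\mu$ in the restriction to $H$ of the irreducible representation $\pi_\lambda$ of $G$ with highest weight $\lambda$. Then $m(\lambda,\mu)=1$ if $$\lambda_1\ge\mu_1\ge\lambda_2\ge\mu_2\ge\cdots\ge\mu_n\ge\lambda_{n+1},$$ and $m(\lambda,\mu)=0$ otherwise.
   Context: All groups are complex algebraic groups and representations are finite dimensional and rational. $GL(m)=GL(m,\mathbb{C})$. Dominant weights of $GL(m)$, with respect to the diagonal torus and the standard ordering, are identified with tuples $(\lambda_1,\ldots,\lambda_m)\in\mathbb{Z}^m$ with $\lambda_1\ge\cdots\ge\lambda_m$. $GL(n)$ is embedded in $GL(n+1)$ as the upper-left block, $g\mapsto \mathrm{diag}(g,1)$. *)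

(* Defs.v *)
From HB Require Import structures.
From mathcomp Require Import all_boot all_order all_algebra.
From mathcomp Require Import boolp reals complex.
From mathcomp Require Import mpoly.

Set Implicit Arguments.
Unset Strict Implicit.
Unset Printing Implicit Defensive.

Import Order.TTheory GRing.Theory Num.Theory.
Local Open Scope ring_scope.

(* The algebraic group GL(m, C) is the set of invertible matrices [unitmx].
   Functions on GL(m, C) are total functions on 'M[C]_m of which only the values
   on [unitmx] matter, and every condition below is restricted to [unitmx]. *)

(* Elements of the coordinate ring C[x_ij, 1/det] of GL(m, C); the variables
   x_ij are indexed by 'I_(m * m) through [mxvec]. *)
Definition regular_function (C : fieldType) (m : nat) (f : 'M[C]_m -> C) : Prop :=
  exists (k : nat) (p : {mpoly C[m * m]}),
    forall g : 'M[C]_m, g \in unitmx ->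
      f g = p.@[fun t => mxvec g 0 t] / (\det g) ^+ k.

Definition rational_representation (C : fieldType) (m : nat) (V : vectType C)
    (rho : 'M[C]_m -> 'End(V)) : Prop :=
  [/\ rho 1%:M = \1%VF,
      {in unitmx &, forall g h : 'M[C]_m, rho (g *m h) = (rho g \o rho h)%VF}
    & forall (phi : 'Hom(V, C^o)) (v : V),
        regular_function (fun g => phi (rho g v))].

Definition invariant_subspace (C : fieldType) (m : nat) (V : vectType C)
    (rho : 'M[C]_m -> 'End(V)) (U : {vspace V}) : Prop :=
  forall g : 'M[C]_m, g \in unitmx -> (rho g @: U <= U)%VS.

Definition irreducible_subspace (C : fieldType) (m : nat) (V : vectType C)
    (rho : 'M[C]_m -> 'End(V)) (U : {vspace V}) : Prop :=
  [/\ invariant_subspace rho U, U != 0%VS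
    & forall W : {vspace V}, invariant_subspace rho W -> (W <= U)%VS ->
        W = 0%VS \/ W = U].

Definition irreducible_representation (C : fieldType) (m : nat) (V : vectType C)
    (rho : 'M[C]_m -> 'End(V)) : Prop :=
  rational_representation rho /\ irreducible_subspace rho fullv.

Definition dominant (m : nat) (lam : 'I_m -> int) : Prop :=
  forall i j : 'I_m, (i <= j)%N -> lam j <= lam i.

(* A highest weight vector is a nonzero eigenvector of the Borel subgroup of
   upper triangular matrices (the one attached to the diagonal torus and the
   positive roots e_i - e_j, i < j): the torus acts by the character lam and
   the unipotent upper triangular matrices act trivially. *)
Definition has_highest_weight (C : fieldType) (m : nat) (V : vectType C)
    (rho : 'M[C]_m -> 'End(V)) (lam : 'I_m -> int) : Prop :=
  exists2 v : V, v != 0 &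
    forall b : 'M[C]_m, b \in unitmx ->
      (forall i j : 'I_m, (j < i)%N -> b i j = 0) ->
      rho b v = (\prod_(i < m) b i i ^ lam i) *: v.

Definition GL_embed (C : fieldType) (n : nat) (g : 'M[C]_n) : 'M[C]_n.+1 :=
  castmx (addn1 n, addn1 n) (block_mx g 0 0 1%:M).

Definition restriction (C : fieldType) (n : nat) (V : vectType C)
    (rho : 'M[C]_n.+1 -> 'End(V)) : 'M[C]_n -> 'End(V) :=
  fun g => rho (GL_embed g).

Definition isomorphic_to_subspace (C : fieldType) (m : nat) (V W : vectType C)
    (rho : 'M[C]_m -> 'End(V)) (sigma : 'M[C]_m -> 'End(W)) (U : {vspace V}) :
    Prop :=
  exists f : 'Hom(W, V),
    [/\ lker f = 0%VS, limg f = U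
      & forall g : 'M[C]_m, g \in unitmx ->
          forall w : W, f (sigma g w) = rho g (f w)].

Definition irreducible_decomposition (C : fieldType) (m : nat) (V : vectType C)
    (rho : 'M[C]_m -> 'End(V)) (r : nat) (U : 'I_r -> {vspace V}) : Prop :=
  [/\ directv (\sum_(i < r) U i), (\sum_(i < r) U i)%VS = fullv
    & forall i : 'I_r, irreducible_subspace rho (U i)].

(* Complete reducibility is part of the notion, and the count is required of
   every decomposition, so that k does not depend on the one chosen. *)
Definition multiplicity_is (C : fieldType) (m : nat) (V W : vectType C)
    (rho : 'M[C]_m -> 'End(V)) (sigma : 'M[C]_m -> 'End(W)) (k : nat) : Prop :=
  (exists (r : nat) (U : 'I_r -> {vspace V}), irreducible_decomposition rho U) /\
  (forall (r : nat) (U : 'I_r -> {vspace V}), irreducible_decomposition rho U ->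
     #|[pred i | `[< isomorphic_to_subspace rho sigma (U i) >]]| = k).

(* Zero-based indices: lam_(i+1) is [lam (widen_ord _ i)] and lam_(i+2) is
   [lam (lift ord0 i)]. *)
Definition interlacing (n : nat) (lam : 'I_n.+1 -> int) (mu : 'I_n -> int) :
    Prop :=
  forall i : 'I_n,
    mu i <= lam (widen_ord (leqnSn n) i) /\ lam (lift ord0 i) <= mu i.

(* Main.v *)
Require Import Defs.
From HB Require Import structures.
From mathcomp Require Import all_boot all_order all_fingroup all_algebra.
From mathcomp Require Import boolp reals complex.
From mathcomp Require Import mpoly.

(** The idea is to turn vectors into functions on the group through an inner
    product [B] for which the adjoint of [g] is its conjugate transpose.

    Such a [B] exists on every irreducible rational representation
    ([contravariant_inner_product]): after clearing denominators, matrix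
    coefficients are polynomials of bounded degree in the entries of a matrix, that
    is, tensors in the affine coordinates up to tensors that vanish as functions.
    On tensors the standard inner product has the required property, by
    inspection of entries, and it descends to the orthogonal complement of the null
    tensors. Orthogonal complements then give complete reducibility under [GL(n)]
    ([complete_reducibility]), since the conjugate transpose preserves [GL(n)].

    Let [v0] be a highest weight vector. The coefficient [g |-> B (g v) v0] of a
    vector [v] is left equivariant, with weight [lam], under lower triangular matrices.
    Conversely every regular function with this equivariance is a coefficient
    ([coefficient_of_equivariant]); this form of the Borel-Weil theorem is
    proved with a reproducing vector for evaluation at the identity and the
    density of lower times upper triangular matrices. It also shows that a
    highest weight determines an irreducible representation
    ([isomorphic_of_weight_vector]), so that the multiplicity sought counts vectors of
    highest weight [mu] for [GL(n)] in [V].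

    The coefficient of such a vector is equivariant on the right, with weight [mu],
    under upper triangular matrices of [GL(n)]. Lower triangular matrices and these
    have a common open orbit in [GL(n + 1)], that of the unipotent matrix whose last
    column consists of ones; hence the coefficient is determined by its value there,
    and the multiplicity is at most one ([spherical_vanishing]). On the open orbit
    the coefficient is, up to a scalar, the product [spherical_function] of powers
    of two families of minors, with exponents [mu_k - lam_(k+1)] and
    [lam_k - mu_k]. A regular function has no poles along the zeros of the minors,
    which forces the interlacing inequalities ([spherical_upper_bound] and
    [spherical_lower_bound]). If they hold, the product is regular on the whole group, so
    it is the coefficient of a vector, and this vector has weight [mu]
    ([weight_vector_exists]). *)

Set Implicit Arguments.
Unset Strict Implicit.
Unset Printing Implicit Defensive.

Import Order.TTheory GRing.Theory Num.Theory.
Local Open Scope ring_scope.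

(** * Subspaces, linear maps and inner products *)

(** A subspace of maximal dimension among those contained in [P] exhausts [P]. *)
Lemma vspace_of_pred (C : fieldType) (V : vectType C) (P : V -> Prop) :
  P 0 -> (forall a u v, P u -> P v -> P (a *: u + v)) ->
  exists U : {vspace V}, forall v, v \in U <-> P v.
Proof.
move=> P0 Plin.
pose inP (U : {vspace V}) := forall v, v \in U -> P v.
pose Q d := `[< exists2 U, inP U & \dim U = d >].
have exQ : exists d, Q d.
  exists 0%N; apply/asboolP; exists 0%VS; last by rewrite dimv0.
  by move=> v; rewrite memv0 => /eqP->.
have boundQ d : Q d -> (d <= \dim {:V})%N.
  by case/asboolP=> U _ <-; apply: dimvS; apply: subvf.
case: (ex_maxnP exQ boundQ) => d /asboolP[U UP dimU] maxd.
exists U => v; split=> [/UP//|Pv].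
have UvP : inP (U + <[v]>)%VS.
  move=> w /memv_addP[u uU [_ /vlineP[k ->] ->]].
  by rewrite addrC; apply/Plin/UP.
have le_d : (\dim (U + <[v]>) <= \dim U)%N.
  by rewrite dimU; apply/maxd/asboolP; exists (U + <[v]>)%VS.
have /eqP-> : U == (U + <[v]>)%VS by rewrite eqEdim addvSl le_d.
by apply: (subvP (addvSr U _)); apply: memv_line.
Qed.

(** The way linear maps are built below: [Rel v w] says that [w] solves a linear
    problem with data [v], and solutions need only be found on a basis. *)
Lemma linear_map_of_rel (C : fieldType) (V W : vectType C)
    (Rel : V -> W -> Prop) :
  (forall a v v' w w', Rel v w -> Rel v' w' ->
     Rel (a *: v + v') (a *: w + w')) ->
  Rel 0 0 ->
  (forall i : 'I_(\dim {:V}), exists w, Rel (vbasis {:V})`_i w) ->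
  exists f : 'Hom(V, W), forall v, Rel v (f v).
Proof.
move=> Rlin R0 /fin_all_exists[w Rw].
pose f v := \sum_(i < \dim {:V}) coord (vbasis {:V}) i v *: w i.
have f_lin : linear f.
  move=> a u v; rewrite /f scaler_sumr -big_split /=; apply: eq_bigr => i _.
  by rewrite linearP scalerDl scalerA.
pose fL := GRing.isLinear.Build _ _ _ _ f f_lin.
pose fl : {linear V -> W} := HB.pack f fL.
exists (linfun fl) => v; rewrite lfunE /= /f.
rewrite {1}(coord_vbasis (memvf v)).
elim/big_rec2: _ => // i y1 y2 _ IH.
by apply: Rlin.
Qed.

Lemma lfun_of_linear (C : fieldType) (V : vectType C) (l : V -> C) :
  (forall a u v, l (a *: u + v) = a * l u + l v) ->
  exists f : 'Hom(V, C^o), forall v, f v = l v.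
Proof.
move=> l_lin; apply: (@linear_map_of_rel C V C^o (fun v w => w = l v)).
- by move=> a u v _ _ -> ->; rewrite l_lin.
- have := l_lin 1 0 0; rewrite scaler0 addr0 mul1r => /(congr1 (fun x => x - l 0)).
  by rewrite subrr addrK.
- by move=> i; exists (l (vbasis {:V})`_i).
Qed.

Record inner_product (C : numClosedFieldType) (V : vectType C)
    (B : V -> V -> C) : Prop := InnerProduct {
  inner_linear : forall a u v w, B (a *: u + v) w = a * B u w + B v w;
  inner_conj : forall u v, B v u = (B u v)^*;
  inner_definite : forall v, B v v = 0 -> v = 0
}.

Section InnerProduct.
Variables (C : numClosedFieldType) (V : vectType C) (B : V -> V -> C).
Hypothesis ipB : inner_product B.

Lemma inner0l w : B 0 w = 0.
Proof.
by have := inner_linear ipB 1 0 0 w; rewrite scaler0 addr0 mul1r =>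
  /(congr1 (fun x => x - B 0 w)); rewrite subrr addrK.
Qed.

Lemma innerDl u v w : B (u + v) w = B u w + B v w.
Proof. by rewrite -{1}[u]scale1r (inner_linear ipB) mul1r. Qed.

Lemma innerZl a u w : B (a *: u) w = a * B u w.
Proof. by rewrite -[a *: u]addr0 (inner_linear ipB) inner0l addr0. Qed.

Lemma innerBl u v w : B (u - v) w = B u w - B v w.
Proof. by rewrite innerDl -scaleN1r innerZl mulN1r. Qed.

Lemma inner0r w : B w 0 = 0.
Proof. by rewrite (inner_conj ipB) inner0l conjC0. Qed.

Lemma innerDr w u v : B w (u + v) = B w u + B w v.
Proof. by rewrite !(inner_conj ipB _ w) innerDl rmorphD. Qed.

Lemma innerZr a w u : B w (a *: u) = a^* * B w u.
Proof. by rewrite !(inner_conj ipB _ w) innerZl rmorphM. Qed.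

Lemma innerBr w u v : B w (u - v) = B w u - B w v.
Proof. by rewrite !(inner_conj ipB _ w) innerBl rmorphB. Qed.

Lemma inner_eq0_sym u v : B u v = 0 -> B v u = 0.
Proof. by move=> Buv; rewrite (inner_conj ipB) Buv conjC0. Qed.

Lemma inner_suml (I : finType) (F : I -> V) w :
  B (\sum_i F i) w = \sum_i B (F i) w.
Proof.
by elim/big_rec2: _ => [|i y1 y2 _ <-]; rewrite ?inner0l ?innerDl.
Qed.

(** Finite-dimensional Riesz representation. The unknown is put in the linear
    slot of the form, so that it is found by inverting a Gram matrix. *)
Lemma riesz (U : {vspace V}) (l : V -> C) :
  (forall a u v, l (a *: u + v) = a * l u + l v) ->
  exists2 k, k \in U & forall p, p \in U -> B p k = l p.
Proof.
move=> l_lin.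
have l0 : l 0 = 0.
  by have := l_lin 1 0 0; rewrite scaler0 addr0 mul1r =>
    /(congr1 (fun x => x - l 0)); rewrite subrr addrK.
pose e := vbasis U; pose r := \dim U.
pose comb (c : 'rV[C]_r) := \sum_(i < r) c 0 i *: e`_i.
have combU c : comb c \in U.
  by apply: memv_suml => i _; rewrite memvZ ?vbasis_mem ?memt_nth.
pose G := \matrix_(i < r, j < r) B e`_i e`_j.
have GE c j : (c *m G) 0 j = B (comb c) e`_j.
  by rewrite inner_suml mxE; apply: eq_bigr => i _; rewrite mxE innerZl.
have B_basis u : (forall j : 'I_r, B u e`_j = 0) ->
    forall p, p \in U -> B u p = 0.
  move=> ue p pU; rewrite (coord_vbasis pU) (inner_conj ipB) inner_suml.
  rewrite big1 ?conjC0 // => j _.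
  by rewrite innerZl (inner_conj ipB) ue conjC0 mulr0.
have Gfree : row_free G.
  apply/inj_row_free => c cG0.
  have comb0 : comb c = 0.
    apply: (inner_definite ipB); apply: B_basis (combU c) => j.
    by rewrite -GE cG0 mxE.
  apply/rowP => i; rewrite mxE.
  by have/freeP/(_ (c 0) comb0 i) := basis_free (vbasisP U).
pose t := \row_(j < r) (l e`_j)^*.
exists (comb (t *m invmx G)) => // p pU.
have Gu : G \in unitmx by rewrite -row_free_unit.
rewrite (coord_vbasis pU) inner_suml.
have -> : l (\sum_(i < \dim U) coord (vbasis U) i p *: (vbasis U)`_i) =
          \sum_(i < \dim U) coord (vbasis U) i p * l (vbasis U)`_i.
  by elim/big_rec2: _ => [|i y1 y2 _ <-].
apply: eq_bigr => j _; rewrite innerZl (inner_conj ipB); congr (_ * _).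
by rewrite -GE mulmxKV // mxE conjCK.
Qed.

Lemma orthogonal_decomposition (U : {vspace V}) v :
  exists u w, [/\ v = u + w, u \in U & forall p, p \in U -> B p w = 0].
Proof.
have [|u uU Bu] := @riesz U (fun p => B p v).
  by move=> a x y; apply: (inner_linear ipB).
exists u, (v - u); split; rewrite ?subrKC // => p /Bu.
by rewrite innerBr => ->; rewrite subrr.
Qed.

End InnerProduct.

(** * Polynomial and regular functions of a matrix *)

(** Polynomial in the entries of the matrix, with values prescribed on singular
    matrices as well; regular functions are these divided by powers of the determinant. *)
Definition polyfun (C : fieldType) m (f : 'M[C]_m -> C) :=
  exists p : {mpoly C[m * m]}, forall x, f x = p.@[fun t => mxvec x 0 t].

Section PolyFun.
Variables (C : fieldType) (m : nat).
Implicit Types f : 'M[C]_m -> C.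

Lemma polyfun_eq f f' : f =1 f' -> polyfun f -> polyfun f'.
Proof. by move=> ff' [p pE]; exists p => x; rewrite -ff' pE. Qed.

Lemma polyfun_const c : polyfun (fun _ : 'M[C]_m => c).
Proof. by exists c%:MP => x; rewrite mevalC. Qed.

Lemma polyfun_entry i j : polyfun (fun x : 'M[C]_m => x i j).
Proof. by exists 'X_(mxvec_index i j) => x; rewrite mevalXU mxvecE. Qed.

Lemma polyfunD f f' : polyfun f -> polyfun f' -> polyfun (fun x => f x + f' x).
Proof. by move=> [p pE] [q qE]; exists (p + q) => x; rewrite mevalD pE qE. Qed.

Lemma polyfunM f f' : polyfun f -> polyfun f' -> polyfun (fun x => f x * f' x).
Proof. by move=> [p pE] [q qE]; exists (p * q) => x; rewrite mevalM pE qE. Qed.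

Lemma polyfun_sum (I : Type) (r : seq I) (F : I -> 'M[C]_m -> C) :
  (forall i, polyfun (F i)) -> polyfun (fun x => \sum_(i <- r) F i x).
Proof.
move=> PF; elim: r => [|i r IH].
  by apply: polyfun_eq (polyfun_const 0) => x; rewrite big_nil.
by apply: polyfun_eq (polyfunD (PF i) IH) => x; rewrite big_cons.
Qed.

Lemma polyfun_prod (I : Type) (r : seq I) (F : I -> 'M[C]_m -> C) :
  (forall i, polyfun (F i)) -> polyfun (fun x => \prod_(i <- r) F i x).
Proof.
move=> PF; elim: r => [|i r IH].
  by apply: polyfun_eq (polyfun_const 1) => x; rewrite big_nil.
by apply: polyfun_eq (polyfunM (PF i) IH) => x; rewrite big_cons.
Qed.

Lemma polyfunX f k : polyfun f -> polyfun (fun x => f x ^+ k).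
Proof.
move=> Pf; elim: k => [|k IH]; first exact: polyfun_const.
by apply: polyfun_eq (polyfunM Pf IH) => x; rewrite exprS.
Qed.

Lemma polyfun_det m' (h : 'M[C]_m -> 'M[C]_m') :
  (forall i j, polyfun (fun x => h x i j)) -> polyfun (fun x => \det (h x)).
Proof.
move=> Ph; apply: polyfun_sum => s; apply: polyfunM (polyfun_const _) _.
by apply: polyfun_prod => i; apply: Ph.
Qed.

Lemma polyfun_comp m' (f : 'M[C]_m' -> C) (h : 'M[C]_m -> 'M[C]_m') :
  polyfun f -> (forall i j, polyfun (fun x => h x i j)) ->
  polyfun (fun x => f (h x)).
Proof.
move=> [p pE] Ph.
have Pt (t : 'I_(m' * m')) : exists q : {mpoly C[m * m]},
    forall x, mxvec (h x) 0 t = q.@[fun t => mxvec x 0 t].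
  by case/mxvec_indexP: t => i j; have [q qE] := Ph i j; exists q => x; rewrite mxvecE.
have [q qE] := fin_all_exists Pt.
exists (p \mPo [tuple q t | t < m' * m']) => x.
rewrite comp_mpoly_meval pE; apply: meval_eq => t.
by rewrite tnth_mktuple -qE.
Qed.

Lemma polyfun_line f x y : polyfun f ->
  exists q : {poly C}, forall s, f (x + s *: y) = q.[s].
Proof.
move=> [p pE].
exists (\sum_(e <- msupp p) p@_e *:
  \prod_(t < m * m) ((mxvec x 0 t)%:P + (mxvec y 0 t) *: 'X) ^+ e t) => s.
rewrite pE mevalE horner_sum; apply: eq_bigr => e _.
rewrite hornerZ horner_prod; congr (_ * _); apply: eq_bigr => t _.
by rewrite horner_exp !hornerE linearD linearZ !mxE mulrC.
Qed.

Lemma regular_polyfun f : regular_function f ->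
  exists k P, polyfun P /\ forall g, g \in unitmx -> f g = P g / \det g ^+ k.
Proof.
by move=> [k [p pE]]; exists k, (fun x => p.@[fun t => mxvec x 0 t]); split => //; exists p.
Qed.

Lemma polyfun_regular f P k : polyfun P ->
  (forall g, g \in unitmx -> f g = P g / \det g ^+ k) -> regular_function f.
Proof. by move=> [p pE] fE; exists k, p => g gu; rewrite fE // pE. Qed.

End PolyFun.

Lemma poly_eq0_of_horner (R : numDomainType) (q : {poly R}) :
  (forall s, q.[s] = 0) -> q = 0.
Proof.
move=> q0; apply/eqP/negPn/negP => /max_poly_roots.
pose rs : seq R := [seq i%:R | i <- iota 0 (size q)].
have rsq : all (root q) rs by apply/allP => x _; apply/rootP.
have urs : uniq rs.
  by rewrite map_inj_uniq ?iota_uniq // => i j /eqP; rewrite eqr_nat => /eqP.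
by move=> /(_ rs rsq urs); rewrite size_map size_iota ltnn.
Qed.

(** Polynomial density: on the line from [x] to [g0], [f * D] is a vanishing
    one-variable polynomial, and the factor coming from [D] is nonzero. *)
Lemma polyfun_density (C : numFieldType) m (f D : 'M[C]_m -> C) g0 :
  polyfun f -> polyfun D -> D g0 != 0 ->
  (forall x, D x != 0 -> f x = 0) -> forall x, f x = 0.
Proof.
move=> Pf PD D0 fD x.
have [q qE] := polyfun_line x (g0 - x) Pf.
have [r rE] := polyfun_line x (g0 - x) PD.
have r0 : r != 0.
  apply: contraNneq D0 => r0; have := rE 1.
  by rewrite r0 horner0 scale1r subrKC => ->.
have /eqP : q * r = 0.
  apply: poly_eq0_of_horner => s; rewrite hornerM -qE -rE.
  by have [->|/fD->] := eqVneq (D (x + s *: (g0 - x))) 0; rewrite (mulr0, mul0r).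
rewrite mulf_eq0 (negPf r0) orbF => /eqP q0.
by have := qE 0; rewrite q0 horner0 scale0r addr0.
Qed.

(** A function [c * s ^ e] that is polynomial in [s] off the origin cannot
    have a pole there. *)
Lemma monomial_exponent_ge0 (C : numFieldType) (q : {poly C}) (c : C) (e : int) :
  c != 0 -> (forall s, s != 0 -> q.[s] = s ^ e * c) -> 0 <= e.
Proof.
move=> c0 qE; case: e qE => // e qE; exfalso.
have : ('X * (q * 'X^(e.+1) - c%:P)) = 0.
  apply: poly_eq0_of_horner => s; rewrite !hornerE.
  have [->|s0] := eqVneq s 0; first by rewrite mul0r.
  by rewrite qE // NegzE -exprnN mulrAC mulVf ?expf_neq0 // mul1r subrr mulr0.
move/eqP; rewrite mulf_eq0 polyX_eq0 /= => /eqP /(congr1 (fun p => p.[0])).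
by rewrite !hornerE expr0n mulr0 sub0r => /eqP; rewrite oppr_eq0 (negPf c0).
Qed.

(** * A space of polynomial functions with an inner product *)

Definition affine_coord (C : fieldType) m (x : 'M[C]_m)
    (s : option ('I_m * 'I_m)) : C :=
  if s is Some ij then x ij.1 ij.2 else 1.

(** Tensors of degree [d] on the affine coordinates: they present the polynomials
    of degree at most [d] in the matrix entries, one polynomial having many
    presentations. *)
Notation tensor C m d := {ffun {ffun 'I_d -> option ('I_m * 'I_m)} -> C^o}.

Section Tensor.
Variables (C : numClosedFieldType) (m d : nat).
Local Notation I := (option ('I_m * 'I_m)).
Local Notation T := (tensor C m d).
Implicit Types (L M : T) (x g : 'M[C]_m).

Definition tensor_eval L x : C :=
  \sum_a (L a : C) * \prod_j affine_coord x (a j).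

Definition adjoint_mx k (g : 'M[C]_k) : 'M[C]_k := map_mx Num.conj g^T.

(** The matrix by which [x |-> x *m g] acts on the affine coordinates. *)
Definition right_mul_coord g (t s : I) : C :=
  match t, s with
  | Some ik, Some ij => (ik.1 == ij.1)%:R * g ik.2 ij.2
  | None, None => 1
  | _, _ => 0
  end.

Definition tensor_act g L : T :=
  [ffun b : {ffun 'I_d -> I} =>
     \sum_(a : {ffun 'I_d -> I}) (\prod_j right_mul_coord g (b j) (a j)) * (L a : C)].

Definition tensor_inner L M : C := \sum_a (L a : C) * (M a : C)^*.

Lemma affine_coord_mulmx x g s :
  affine_coord (x *m g) s = \sum_t affine_coord x t * right_mul_coord g t s.
Proof.
rewrite (bigD1 None) //= (reindex_omap Some id) => [|[]//] /=.
under eq_bigl do rewrite eqxx.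
case: s => [[i j]|] /=; last by rewrite mulr1 big1 ?addr0 // => t _; rewrite mulr0.
rewrite mulr0 add0r mxE -(pair_bigA _ (fun i' k => x i' k * ((i' == i)%:R * g k j))) /=.
rewrite [RHS](bigD1 i) //= [X in _ + X]big1 => [|i' /negPf ne_i].
  by rewrite addr0; apply: eq_bigr => k _; rewrite eqxx mul1r.
by apply: big1 => k _; rewrite ne_i mul0r mulr0.
Qed.

Lemma tensor_eval_act g L x :
  tensor_eval (tensor_act g L) x = tensor_eval L (x *m g).
Proof.
rewrite /tensor_eval.
under [RHS]eq_bigr => a _.
  under eq_bigr => j _ do rewrite affine_coord_mulmx.
  rewrite bigA_distr_bigA /= mulr_sumr.
  over.
rewrite exchange_big /=; apply: eq_bigr => b _.
rewrite ffunE mulr_suml; apply: eq_bigr => a _.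
by rewrite big_split /= mulrAC mulrC; congr (_ * _); apply: mulrC.
Qed.

Lemma right_mul_coord_adjoint g s t :
  right_mul_coord (adjoint_mx g) t s = (right_mul_coord g s t)^*.
Proof.
case: s t => [[i j]|] [[k l]|] /=; rewrite ?conjC0 ?conjC1 //.
by rewrite rmorphM rmorph_nat !mxE eq_sym.
Qed.

(** The coordinate matrix of right translation by the conjugate transpose is itself
    the conjugate transpose, and so are its entrywise products. *)
Lemma tensor_act_adjoint g L M :
  tensor_inner (tensor_act g L) M = tensor_inner L (tensor_act (adjoint_mx g) M).
Proof.
rewrite /tensor_inner.
under eq_bigr => b _ do rewrite ffunE mulr_suml.
rewrite exchange_big /=; apply: eq_bigr => a _.
rewrite ffunE rmorph_sum mulr_sumr; apply: eq_bigr => b _ /=.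
rewrite rmorphM rmorph_prod /= mulrA [_ * L a]mulrC; congr (_ * _ * _).
by apply: eq_bigr => j _; rewrite right_mul_coord_adjoint conjCK.
Qed.

Lemma tensor_inner_product : inner_product tensor_inner.
Proof.
split=> [a u v w|u v|v].
- rewrite /tensor_inner mulr_sumr -big_split; apply: eq_bigr => i _ /=.
  by rewrite !ffunE mulrDl mulrA.
- rewrite /tensor_inner rmorph_sum; apply: eq_bigr => i _ /=.
  by rewrite rmorphM /= conjCK mulrC.
- move=> /eqP; rewrite psumr_eq0 => [/allP v0|i _]; last exact: mul_conjC_ge0.
  apply/ffunP => i; rewrite ffunE.
  by have := v0 i (mem_index_enum i); rewrite mul_conjC_eq0 => /eqP.
Qed.

Lemma tensor_eval_linear a L M x :
  tensor_eval (a *: L + M) x = a * tensor_eval L x + tensor_eval M x.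
Proof.
rewrite /tensor_eval mulr_sumr -big_split; apply: eq_bigr => i _ /=.
by rewrite !ffunE mulrDl mulrA.
Qed.

End Tensor.

Section TensorPresentation.
Variables (C : numClosedFieldType) (m : nat).

(** The variables of the monomial are listed with multiplicity, and the list is
    padded to length [d] with the constant coordinate [None]. *)
Lemma tensor_of_monomial d (e : 'X_{1..(m * m)}) : (mdeg e <= d)%N ->
  exists L : tensor C m d, forall x,
    tensor_eval L x = \prod_t mxvec x 0 t ^+ e t.
Proof.
move=> le_d.
have [c cE] : exists c : 'I_(m * m) -> 'I_m * 'I_m,
    forall t (x : 'M[C]_m), mxvec x 0 t = x (c t).1 (c t).2.
  apply: (@fin_all_exists _ _
    (fun t ij => forall x : 'M[C]_m, mxvec x 0 t = x ij.1 ij.2)) => t.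
  by case/mxvec_indexP: t => i j; exists (i, j) => x; rewrite mxvecE.
pose s := flatten [seq nseq (e t) t | t <- index_enum 'I_(m * m)].
have size_s : size s = mdeg e.
  rewrite /s size_flatten /shape -map_comp sumnE big_map mdegE.
  by apply: eq_bigr => t _; rewrite /= size_nseq.
pose b : seq (option ('I_m * 'I_m)) := [seq Some (c t) | t <- s].
pose a : {ffun 'I_d -> option ('I_m * 'I_m)} := [ffun j : 'I_d => nth None b j].
exists [ffun a' => (a' == a)%:R] => x.
rewrite /tensor_eval (bigD1 a) //= ffunE eqxx mul1r [X in _ + X]big1 ?addr0; last first.
  by move=> a' /negPf ne_a; rewrite ffunE ne_a mul0r.
transitivity (\prod_(0 <= j < d) affine_coord x (nth None b j)).
  by rewrite big_mkord; apply: eq_bigr => j _; rewrite ffunE.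
rewrite (@big_cat_nat _ _ _ (size s)) ?size_s //= [X in _ * X]big_nat_cond.
rewrite [X in _ * X]big1 ?mulr1 => [|j /andP[/andP[lej _] _]]; last first.
  by rewrite nth_default // size_map size_s.
have -> : mdeg e = size b by rewrite size_map size_s.
rewrite -(big_nth None predT (affine_coord x)) /b big_map /s big_flatten big_map /=.
apply: eq_bigr => t _; rewrite big_nseq /= cE.
by elim: (e t) => [|k IH]; rewrite ?expr0 //= IH exprS.
Qed.

Lemma tensor_of_polyfun (f : 'M[C]_m -> C) : polyfun f ->
  exists d0, forall d, (d0 <= d)%N -> exists L : tensor C m d,
    forall x, tensor_eval L x = f x.
Proof.
move=> [p pE]; exists (msize p) => d le_d.
have: {subset msupp p <= msupp p} by [].
have {pE} pE x : f x = \sum_(e <- msupp p) p@_e * \prod_t mxvec x 0 t ^+ e t.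
  by rewrite pE mevalE.
suff: forall s, {subset s <= msupp p} -> exists L : tensor C m d, forall x,
    tensor_eval L x = \sum_(e <- s) p@_e * \prod_t mxvec x 0 t ^+ e t.
  by move=> H /H[L LE]; exists L => x; rewrite LE pE.
elim=> [|e s IH] sub.
  exists 0 => x; rewrite big_nil /tensor_eval big1 // => a _.
  by rewrite ffunE mul0r.
have [|L LE] := IH; first by move=> e' e's; apply: sub; rewrite inE e's orbT.
have [|M ME] := @tensor_of_monomial d e.
  by apply/(leq_trans (ltnW (msize_mdeg_lt _)) le_d)/sub; rewrite inE eqxx.
by exists (p@_e *: M + L) => x; rewrite tensor_eval_linear ME LE big_cons.
Qed.

(** The powers of the determinant and the degrees are added up, so that all the
    functions land in a single space of tensors. *)
Lemma tensor_of_regular (I : finType) (F : I -> 'M[C]_m -> C) :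
  (forall i, regular_function (F i)) ->
  exists K d (L : I -> tensor C m d), forall i g, g \in unitmx ->
    tensor_eval (L i) g = F i g * \det g ^+ K.
Proof.
move=> Freg.
have /fin_all_exists[k /fin_all_exists[P PE]] i := regular_polyfun (Freg i).
pose K := \sum_i k i.
have leK i : (k i <= K)%N by rewrite /K (bigD1 i) //= leq_addr.
have /fin_all_exists[d0 dE] i : exists d0, forall d, (d0 <= d)%N ->
    exists L : tensor C m d, forall x,
    tensor_eval L x = P i x * \det x ^+ (K - k i).
  apply: tensor_of_polyfun; apply: polyfunM; first by case: (PE i).
  by apply/polyfunX/polyfun_det => u v; apply: polyfun_entry.
have le_d i : (d0 i <= \sum_i d0 i)%N by rewrite (bigD1 i) //= leq_addr.
have /fin_all_exists[L LE] i := dE i _ (le_d i).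
exists K, (\sum_i d0 i)%N, L => i g gu; rewrite LE.
case: (PE i) => _ -> //; have dg : \det g != 0 by rewrite -unitfE -unitmxE.
by rewrite -{2}(subnKC (leK i)) exprD mulrA mulfVK ?expf_neq0.
Qed.

End TensorPresentation.

Section ReducedTensor.
Variables (C : numClosedFieldType) (m d : nat).
Local Notation T := (tensor C m d).
Implicit Types L M : T.

Definition null_tensor L :=
  forall x, x \in unitmx -> tensor_eval L x = 0.

(** Reduced tensors form the orthogonal complement of the null tensors; a
    polynomial function has exactly one reduced presentation. *)
Definition reduced_tensor L :=
  forall M, null_tensor M -> tensor_inner L M = 0.

Lemma reduced_tensor_linear a L M :
  reduced_tensor L -> reduced_tensor M -> reduced_tensor (a *: L + M).
Proof.
move=> rL rM N nN.
by rewrite (inner_linear (tensor_inner_product _ _ _)) rL // rM // mulr0 addr0.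
Qed.

Lemma reduced_tensor0 : reduced_tensor 0.
Proof. by move=> M _; rewrite (inner0l (tensor_inner_product _ _ _)). Qed.

Lemma null_tensorB L M :
  (forall x, x \in unitmx -> tensor_eval L x = tensor_eval M x) ->
  null_tensor (L - M).
Proof.
move=> LM x xu; rewrite addrC -scaleN1r tensor_eval_linear LM //.
by rewrite mulN1r addNr.
Qed.

Lemma reduced_tensor_inj L M : reduced_tensor L -> reduced_tensor M ->
  (forall x, x \in unitmx -> tensor_eval L x = tensor_eval M x) -> L = M.
Proof.
move=> rL rM LM; apply/eqP; rewrite -subr_eq0; apply/eqP.
apply: (inner_definite (tensor_inner_product _ _ _)).
have rLM : reduced_tensor (L - M).
  by rewrite addrC -scaleN1r; apply: reduced_tensor_linear.
by apply/rLM/null_tensorB.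
Qed.

Lemma reduced_tensor_exists L : exists2 M, reduced_tensor M &
  forall x, x \in unitmx -> tensor_eval M x = tensor_eval L x.
Proof.
have [||Z ZP] := @vspace_of_pred C T null_tensor.
- by move=> x _; rewrite /tensor_eval big1 // => a _; rewrite ffunE mul0r.
- by move=> a u v nu nv x xu; rewrite tensor_eval_linear nu // nv // mulr0 addr0.
have [N [M [-> NZ ort]]] :=
  orthogonal_decomposition (tensor_inner_product C m d) Z L.
exists M => [P /ZP/ort|x xu].
  by apply: (inner_eq0_sym (tensor_inner_product _ _ _)).
rewrite -[N]scale1r tensor_eval_linear.
by have /ZP-> := NZ; rewrite // mulr0 add0r.
Qed.

Lemma adjoint_mxK (g : 'M[C]_m) : adjoint_mx (adjoint_mx g) = g.
Proof. by apply/matrixP => i j; rewrite !mxE conjCK. Qed.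

Lemma det_adjoint_mx (g : 'M[C]_m) : \det (adjoint_mx g) = (\det g)^*.
Proof. by rewrite /adjoint_mx det_map_mx det_tr. Qed.

Lemma unitmx_adjoint (g : 'M[C]_m) :
  (adjoint_mx g \in unitmx) = (g \in unitmx).
Proof. by rewrite !unitmxE det_adjoint_mx !unitfE conjC_eq0. Qed.

(** The adjoint translation preserves the null tensors, so this one preserves their
    orthogonal complement. *)
Lemma reduced_tensor_act g L :
  g \in unitmx -> reduced_tensor L -> reduced_tensor (tensor_act g L).
Proof.
move=> gu rL M nM; rewrite tensor_act_adjoint; apply: rL => x xu.
by rewrite tensor_eval_act nM // unitmx_mul xu unitmx_adjoint.
Qed.

End ReducedTensor.

(** * The contravariant inner product *)

(** The matrix coefficients along [xi], cleared of denominators, map a representation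
    to tensors; uniqueness of reduced presentations makes the map linear and
    equivariant up to a power of the determinant. One more regular function [F] is
    put over the same denominator, to be compared with the coefficients. *)
Lemma matrix_coefficient_model (C : numClosedFieldType) m (V : vectType C)
    (rho : 'M[C]_m -> 'End(V)) (xi : 'Hom(V, C^o)) (F : 'M[C]_m -> C) :
  rational_representation rho -> regular_function F ->
  exists K d (iota : 'Hom(V, tensor C m d)) (Ft : tensor C m d),
  [/\ forall v, reduced_tensor (iota v),
      forall v g, g \in unitmx ->
        tensor_eval (iota v) g = xi (rho g v) * \det g ^+ K,
      forall v g, g \in unitmx ->
        tensor_act g (iota v) = \det g ^+ K *: iota (rho g v),
      reduced_tensor Ft
    & forall g, g \in unitmx -> tensor_eval Ft g = F g * \det g ^+ K].
Proof.
move=> [rho1 rhoM rhoreg] Freg.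
pose G (i : option 'I_(\dim {:V})) :=
  if i is Some i then fun g => xi (rho g (vbasis {:V})`_i) else F.
have [|K [d [L LE]]] := @tensor_of_regular C m _ G.
  by case=> [i|] //=; apply: rhoreg.
have [Ft rFt FtE] := reduced_tensor_exists (L None).
pose Rel v (M : tensor C m d) := reduced_tensor M /\ forall g, g \in unitmx ->
  tensor_eval M g = xi (rho g v) * \det g ^+ K.
have [||i|iota iotaP] := @linear_map_of_rel C V (tensor C m d) Rel.
- move=> a v v' w w' [rw wE] [rw' w'E]; split; first exact: reduced_tensor_linear.
  move=> g gu; rewrite tensor_eval_linear wE // w'E // !linearP /=.
  by rewrite mulrDl mulrA.
- split; first exact: reduced_tensor0.
  move=> g gu; rewrite !linear0 mul0r /tensor_eval big1 // => a _.
  by rewrite ffunE mul0r.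
- have [M rM ME] := reduced_tensor_exists (L (Some i)).
  by exists M; split=> // g gu; rewrite ME // LE.
exists K, d, iota, Ft; split=> // [v|v|v g gu|g gu]; try by case: (iotaP v).
  apply: reduced_tensor_inj => [||x xu].
  - by apply: reduced_tensor_act => //; case: (iotaP v).
  - rewrite -[_ *: _]addr0; apply: reduced_tensor_linear; last exact: reduced_tensor0.
    by case: (iotaP (rho g v)).
  rewrite -[_ *: _]addr0 tensor_eval_linear tensor_eval_act.
  rewrite [X in _ + X]big1 ?addr0 => [|a _]; last by rewrite ffunE mul0r.
  case: (iotaP v) => _ ->; last by rewrite unitmx_mul xu gu.
  case: (iotaP (rho g v)) => _ -> //.
  by rewrite rhoM // comp_lfunE det_mulmx exprMn mulrA mulrC.
by rewrite FtE // LE.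
Qed.

Definition contravariant (C : numClosedFieldType) m (V : vectType C)
    (rho : 'M[C]_m -> 'End(V)) (B : V -> V -> C) :=
  forall g, g \in unitmx -> forall v w,
    B (rho g v) w = B v (rho (adjoint_mx g) w).

Lemma representationV (C : fieldType) m (V : vectType C)
    (rho : 'M[C]_m -> 'End(V)) (g h : 'M[C]_m) v :
  rational_representation rho -> g \in unitmx -> h \in unitmx ->
  rho g (rho h v) = rho (g *m h) v.
Proof. by move=> [_ rhoM _] gu hu; rewrite rhoM // comp_lfunE. Qed.

(** The vectors of [U] satisfying [P] form an invariant subspace other than [U]. *)
Lemma irreducible_pred0 (C : fieldType) m (V : vectType C)
    (rho : 'M[C]_m -> 'End(V)) (U : {vspace V}) (P : V -> Prop) v0 :
  irreducible_subspace rho U ->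
  P 0 -> (forall a u v, P u -> P v -> P (a *: u + v)) ->
  (forall g, g \in unitmx -> forall v, P v -> P (rho g v)) ->
  v0 \in U -> ~ P v0 -> forall v, v \in U -> P v -> v = 0.
Proof.
move=> [Uinv _ Uirr] P0 Plin Pinv v0U nPv0 v vU Pv.
have [||W WP] := @vspace_of_pred C V (fun v => v \in U /\ P v).
- by split; rewrite ?mem0v.
- move=> a x y [xU Px] [yU Py]; split; last exact: Plin.
  by rewrite memvD ?memvZ.
have [||W0|WU] := Uirr W.
- move=> g gu; apply/subvP => _ /memv_imgP[w /WP[wU Pw] ->]; apply/WP; split.
    by apply: (subvP (Uinv g gu)); apply: memv_img.
  exact: Pinv.
- by apply/subvP => w /WP[].
- by apply/eqP; rewrite -memv0 -W0; apply/WP.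
by case: nPv0; have /WP[] : v0 \in W by rewrite WU.
Qed.

(** The inner product of tensors, for which right translation by [g] is adjoint
    to right translation by its conjugate transpose, is pulled back along the map
    given by matrix coefficients. That map is injective by irreducibility, and the
    two determinant twists compensate. *)
Lemma contravariant_inner_product (C : numClosedFieldType) m (V : vectType C)
    (rho : 'M[C]_m -> 'End(V)) :
  irreducible_representation rho ->
  exists2 B, inner_product B & contravariant rho B.
Proof.
move=> [rat irr]; have [rho1 rhoM rhoreg] := rat; have [_ V0 _] := irr.
pose v0 := vpick {:V}; have v0n0 : v0 != 0 by rewrite vpick0.
have [i xiv0] : exists i, coord (vbasis {:V}) i v0 != 0.
  apply: contrapT => all0; case/eqP: v0n0; rewrite [v0](coord_vbasis (memvf v0)).
  apply: big1 => i _; have [->|nz] := eqVneq (coord (vbasis {:V}) i v0) 0.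
    by rewrite scale0r.
  by case: all0; exists i.
have [|xi xiE] := @lfun_of_linear C V (coord (vbasis {:V}) i).
  by move=> a u v; rewrite linearP.
have F0 : regular_function (fun _ : 'M[C]_m => 0 : C).
  by exists 0%N, 0 => g _; rewrite meval0 mul0r.
have [K [d [iota [_ [iota_r iotaE iota_act _ _]]]]] :=
  matrix_coefficient_model xi rat F0.
have ipT := tensor_inner_product C m d.
have iota_inj v : iota v = 0 -> v = 0.
  move=> iv0.
  apply: (@irreducible_pred0 _ _ _ rho fullv
    (fun v => forall g, g \in unitmx -> xi (rho g v) = 0) v0) => //.
  - by move=> g _; rewrite !linear0.
  - by move=> a x y Px Py g gu; rewrite !linearP /= Px // Py // scaler0 addr0.
  - move=> h hu x Px g gu; rewrite representationV //.
    by apply: Px; rewrite unitmx_mul gu.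
  - exact: memvf.
  - move=> /(_ 1%:M (unitmx1 _ _)); rewrite rho1 id_lfunE xiE.
    by move/eqP: xiv0.
  - exact: memvf.
  move=> g gu; have dg : \det g != 0 by rewrite -unitfE -unitmxE.
  apply/(mulIf (expf_neq0 K dg)); rewrite mul0r -iotaE // iv0.
  by rewrite /tensor_eval big1 // => a _; rewrite ffunE mul0r.
exists (fun v w => tensor_inner (iota v) (iota w)).
  split=> [a u v w|u v|v /(inner_definite ipT)/iota_inj//].
  - by rewrite linearP (inner_linear ipT).
  - exact: (inner_conj ipT).
move=> g gu v w.
have dg : \det g ^+ K != 0 by rewrite expf_neq0 // -unitfE -unitmxE.
apply: (mulfI dg); rewrite -(innerZl ipT) -iota_act // tensor_act_adjoint.
rewrite iota_act ?unitmx_adjoint // (innerZr ipT).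
by rewrite det_adjoint_mx -rmorphXn /= conjCK.
Qed.

(** * Leading minors and the big cell *)

Section LeadingMinor.
Variables (C : fieldType) (m : nat).
Implicit Types (b g u : 'M[C]_m) (k : nat).

Definition lower_triangular b := forall i j : 'I_m, (i < j)%N -> b i j = 0.
Definition upper_triangular b := forall i j : 'I_m, (j < i)%N -> b i j = 0.
Definition upper_unitriangular b :=
  forall i j : 'I_m, (j <= i)%N -> b i j = (i == j)%:R.

(** Completing the leading block by an identity keeps all leading minors
    determinants of matrices of one fixed size. *)
Definition leading_block k g : 'M[C]_m :=
  \matrix_(i, j) if (i < k)%N && (j < k)%N then g i j else (i == j)%:R.

Definition leading_minor k g := \det (leading_block k g).

Lemma det_upper_triangular u : upper_triangular u -> \det u = \prod_i u i i.
Proof.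
move=> ut; rewrite -det_tr det_trig; last first.
  by apply/is_trig_mxP => i j ij; rewrite mxE ut.
by apply: eq_bigr => i _; rewrite mxE.
Qed.

Lemma upper_unitriangularW u : upper_unitriangular u -> upper_triangular u.
Proof.
by move=> uu i j ji; rewrite uu 1?ltnW //; case: eqP ji => // ->; rewrite ltnn.
Qed.

Lemma unitmx_unitriangular u : upper_unitriangular u -> u \in unitmx.
Proof.
move=> uu; rewrite unitmxE unitfE det_upper_triangular; last exact: upper_unitriangularW.
by rewrite big1 ?oner_eq0 // => i _; rewrite uu ?eqxx.
Qed.

Lemma leading_block_mulr k g b :
  (forall l j : 'I_m, (j < k)%N -> (j < l)%N -> b l j = 0) ->
  leading_block k (g *m b) = leading_block k g *m leading_block k b.
Proof.
move=> bt; apply/matrixP => i j; rewrite !mxE.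
have [jk|kj] := ltnP j k; last first.
  rewrite andbF (bigD1 j) //= !mxE (ltnNge j) kj andbF /= eqxx mulr1.
  rewrite big1 ?addr0 // => l /negPf lj.
  by rewrite !mxE (ltnNge j) kj andbF /= lj mulr0.
have [ik|ki] /= := ltnP i k.
  apply: eq_bigr => l _; rewrite !mxE ik jk andbT /=.
  have [lk|kl] := ltnP l k; first by [].
  rewrite bt ?mulr0 ?(leq_trans jk) //.
  by rewrite -val_eqE /= ltn_eqF ?mul0r // (leq_trans ik).
rewrite (bigD1 i) //= !mxE (ltnNge i) ki /= eqxx mul1r.
rewrite big1 ?addr0 // => l /negPf li.
by rewrite !mxE (ltnNge i) ki /= eq_sym li mul0r.
Qed.

Lemma leading_minor_upper k b :
  (forall l j : 'I_m, (l < k)%N -> (j < l)%N -> b l j = 0) ->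
  leading_minor k b = \prod_(i < m | (i < k)%N) b i i.
Proof.
move=> bt; rewrite /leading_minor det_upper_triangular => [|i j ji].
  rewrite [RHS]big_mkcond; apply: eq_bigr => i _.
  by rewrite mxE andbb eqxx; case: ifP.
rewrite mxE; case: ifP => [/andP[ik _]|_]; first exact: bt.
by rewrite -val_eqE /= gtn_eqF.
Qed.

Lemma leading_minor_mulr k g b :
  (forall l j : 'I_m, (j < k)%N -> (j < l)%N -> b l j = 0) ->
  leading_minor k (g *m b) =
  leading_minor k g * \prod_(i < m | (i < k)%N) b i i.
Proof.
move=> bt; rewrite -leading_minor_upper => [|l j lk jl].
  by rewrite /leading_minor leading_block_mulr // det_mulmx.
by apply: bt => //; apply: ltn_trans jl lk.
Qed.

Lemma leading_minor_tr k g : leading_minor k g^T = leading_minor k g.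
Proof.
rewrite /leading_minor -[RHS]det_tr; congr (\det _); apply/matrixP => i j.
by rewrite !mxE andbC eq_sym.
Qed.

Lemma leading_minor_mull k g b : lower_triangular b ->
  leading_minor k (b *m g) =
  (\prod_(i < m | (i < k)%N) b i i) * leading_minor k g.
Proof.
move=> bt; rewrite -leading_minor_tr trmx_mul leading_minor_mulr => [|l j _ jl].
  rewrite leading_minor_tr mulrC; congr (_ * _).
  by apply: eq_bigr => i _; rewrite mxE.
by rewrite mxE bt.
Qed.

Lemma leading_minor_full g : leading_minor m g = \det g.
Proof.
by congr (\det _); apply/matrixP => i j; rewrite !mxE !ltn_ord.
Qed.

Lemma leading_minor1 k : leading_minor k 1%:M = 1.
Proof.
rewrite leading_minor_upper => [|l j _ jl].
  by apply: big1 => i _; rewrite mxE eqxx.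
by rewrite mxE -val_eqE /= gtn_eqF.
Qed.

(** Gaussian elimination in closed form: row [i] of the lower triangular factor
    is row [i] of the inverse of the leading block of size [i + 1]. *)
Lemma lower_mul_unitriangular g :
  (forall k : 'I_m, leading_minor k.+1 g != 0) ->
  exists b, [/\ lower_triangular b, b \in unitmx & upper_unitriangular (b *m g)].
Proof.
move=> g0; pose T (i : 'I_m) := leading_block i.+1 g.
have Tu i : T i \in unitmx by rewrite unitmxE unitfE g0.
pose b := \matrix_(i, l) invmx (T i) i l.
have inv_far (i l : 'I_m) : (i < l)%N -> invmx (T i) i l = 0.
  move=> il; have := mulVmx (Tu i) => /matrixP/(_ i l).
  rewrite !mxE -[(i == l)]val_eqE /= ltn_eqF // (bigD1 l) //= mxE ltnS.
  rewrite (leqNgt l) il andbF eqxx mulr1.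
  rewrite big1 ?addr0 // => l' /negPf l'l.
  by rewrite mxE ltnS (ltnS l) (leqNgt l) il andbF l'l mulr0.
have bl : lower_triangular b by move=> i j ij; rewrite mxE inv_far.
have bu : upper_unitriangular (b *m g).
  move=> i j ji; have := mulVmx (Tu i) => /matrixP/(_ i j).
  rewrite !mxE => <-; apply: eq_bigr => l _; rewrite !mxE !ltnS ji andbT.
  by case: leqP => // il; rewrite inv_far ?mul0r.
exists b; split=> //; have := unitmx_unitriangular bu.
by rewrite unitmx_mul => /andP[].
Qed.

Lemma polyfun_leading_minor k : polyfun (leading_minor k).
Proof.
apply: (polyfun_det (h := leading_block k)) => i j; case: (boolP ((i < k) && (j < k))%N) => ij.
  by apply: polyfun_eq (polyfun_entry C i j) => x; rewrite mxE ij.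
by apply: polyfun_eq (polyfun_const m (i == j)%:R) => x; rewrite mxE (negPf ij).
Qed.

End LeadingMinor.

Lemma polyfun_det_id (C : fieldType) m : polyfun (fun x : 'M[C]_m => \det x).
Proof. by apply: polyfun_det => i j; apply: polyfun_entry. Qed.

(** Products of lower triangular and unitriangular matrices are dense: they contain
    all matrices with nonzero leading minors. *)
Lemma big_cell_vanishing (C : numFieldType) m (P chi : 'M[C]_m -> C) :
  polyfun P ->
  (forall b, b \in unitmx -> lower_triangular b -> chi b != 0) ->
  (forall b g, b \in unitmx -> g \in unitmx -> lower_triangular b ->
     P (b *m g) = chi b * P g) ->
  (forall u, upper_unitriangular u -> P u = 0) ->
  forall x, P x = 0.
Proof.
move=> PP chi0 Pchi Pu.
apply: (polyfun_density (g0 := 1%:M)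
  (D := fun x => \det x * \prod_(k < m) leading_minor k.+1 x)) => //.
- apply: polyfunM; first exact: polyfun_det_id.
  by apply: polyfun_prod => k; apply: polyfun_leading_minor.
- rewrite det1 mul1r big1 ?oner_eq0 // => k _; exact: leading_minor1.
move=> x; rewrite mulf_eq0 negb_or => /andP[dx /prodf_neq0 lx].
have [|b [bl bu bx]] := @lower_mul_unitriangular _ _ x; first by move=> k; apply: lx.
apply: (mulfI (chi0 b bu bl)); rewrite mulr0 -Pchi ?Pu //.
by rewrite unitmxE unitfE.
Qed.

Lemma polyfun_tensor_eval (C : numClosedFieldType) m d (L : tensor C m d) :
  polyfun (tensor_eval L).
Proof.
apply: polyfun_sum => a; apply: polyfunM; first exact: polyfun_const.
apply: polyfun_prod => j; case: (a j) => [[i k]|] /=; first exact: polyfun_entry.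
exact: polyfun_const.
Qed.

(** * Functions with the highest weight equivariance come from vectors *)

Definition weight_char (C : fieldType) m (lam : 'I_m -> int) (b : 'M[C]_m) : C :=
  \prod_i b i i ^ lam i.

Definition weight_vector (C : fieldType) m (V : vectType C)
    (rho : 'M[C]_m -> 'End(V)) (lam : 'I_m -> int) (v : V) :=
  forall b, b \in unitmx -> upper_triangular b ->
    rho b v = weight_char lam b *: v.

Lemma lower_triangular_tr (C : fieldType) m (b : 'M[C]_m) :
  lower_triangular b -> upper_triangular b^T.
Proof. by move=> bl i j ji; rewrite mxE bl. Qed.

Lemma diag_unit_neq0 (C : fieldType) m (b : 'M[C]_m) :
  b \in unitmx -> lower_triangular b \/ upper_triangular b ->
  forall i, b i i != 0.
Proof.
move=> bu tri i; move: bu; rewrite unitmxE unitfE => bu; apply: contra_neq bu => bi.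
case: tri => [/lower_triangular_tr tri|tri]; first rewrite -det_tr.
  all: by rewrite det_upper_triangular // (bigD1 i) //= ?mxE bi mul0r.
Qed.

Lemma weight_char_neq0 (C : fieldType) m lam (b : 'M[C]_m) :
  b \in unitmx -> lower_triangular b \/ upper_triangular b ->
  weight_char lam b != 0.
Proof.
move=> bu tri; apply/prodf_neq0 => i _; apply: expfz_neq0; exact: diag_unit_neq0.
Qed.

Lemma weight_char_unitriangular (C : fieldType) m lam (u : 'M[C]_m) :
  upper_unitriangular u -> weight_char lam u = 1.
Proof. by move=> uu; apply: big1 => i _; rewrite uu // eqxx exp1rz. Qed.

Section WeightFunctions.
Variables (C : numClosedFieldType) (m : nat) (V : vectType C).
Variables (rho : 'M[C]_m -> 'End(V)) (B : V -> V -> C).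
Hypotheses (rat : rational_representation rho) (ipB : inner_product B).
Hypothesis (conB : contravariant rho B).
Variables (lam : 'I_m -> int) (v0 : V).
Hypotheses (wv0 : weight_vector rho lam v0) (v0n0 : v0 != 0).

Lemma weight_char_adjoint (b : 'M[C]_m) :
  weight_char lam (adjoint_mx b) = (weight_char lam b)^*.
Proof.
rewrite /weight_char rmorph_prod; apply: eq_bigr => i _ /=.
by rewrite fmorphXz !mxE.
Qed.

(** The conjugate transpose of [b] is upper triangular and acts on [v0] by the
    conjugate of the weight of [b]: the inner product with a highest weight vector
    provides the lowest weight functional that this argument needs. *)
Lemma coefficient_equivariant v (b g : 'M[C]_m) :
  b \in unitmx -> g \in unitmx -> lower_triangular b ->
  B (rho (b *m g) v) v0 = weight_char lam b * B (rho g v) v0.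
Proof.
move=> bu gu bl; rewrite -(representationV v rat bu gu) (conB bu) // wv0.
- by rewrite (innerZr ipB) weight_char_adjoint conjCK.
- by rewrite unitmx_adjoint.
by move=> i j ji; rewrite !mxE bl ?conjC0.
Qed.

Lemma coefficient_regular v : regular_function (fun g => B (rho g v) v0).
Proof.
have [|xi xiE] := @lfun_of_linear C V (B^~ v0).
  by move=> a x y; apply: (inner_linear ipB).
have -> : (fun g => B (rho g v) v0) = (fun g => xi (rho g v)).
  by apply: funext => g; rewrite xiE.
by case: rat.
Qed.

(** The functions that are equivariant like the coefficients [B (rho g v) v0] but
    orthogonal to all of them form a space [U], stable under right translation. In [U],
    evaluation at the identity is represented by a function [k]; its
    uniqueness makes [k] right invariant under unitriangular matrices, hence, by density of
    the big cell, a multiple of the coefficient of [v0] itself. Being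
    orthogonal to the coefficients, [k] vanishes, and so does [U]. *)
Lemma coefficient_of_equivariant (F : 'M[C]_m -> C) :
  regular_function F ->
  (forall b g, b \in unitmx -> g \in unitmx -> lower_triangular b ->
     F (b *m g) = weight_char lam b * F g) ->
  exists w, forall g, g \in unitmx -> F g = B (rho g w) v0.
Proof.
move=> Freg Feq.
have [|xi xiE] := @lfun_of_linear C V (B^~ v0).
  by move=> a x y; apply: (inner_linear ipB).
have [K [d [iota [Ft [iota_r iotaE iota_act Ftr FtE]]]]] :=
  matrix_coefficient_model xi rat Freg.
have ipT := tensor_inner_product C m d.
pose chi (b : 'M[C]_m) := weight_char lam b * \det b ^+ K.
pose equiv (p : tensor C m d) := forall b g : 'M[C]_m, b \in unitmx -> g \in unitmx ->
  lower_triangular b -> tensor_eval p (b *m g) = chi b * tensor_eval p g.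
have iota_eq v : equiv (iota v).
  move=> b g bu gu bl; rewrite !iotaE ?unitmx_mul ?bu // !xiE.
  by rewrite coefficient_equivariant // det_mulmx exprMn mulrACA.
have Ft_eq : equiv Ft.
  move=> b g bu gu bl; rewrite !FtE ?unitmx_mul ?bu //.
  by rewrite Feq // det_mulmx exprMn mulrACA.
have equiv_lin a p q : equiv p -> equiv q -> equiv (a *: p + q).
  move=> ep eq b g bu gu bl; rewrite !tensor_eval_linear ep // eq //.
  by rewrite mulrDr mulrCA.
pose Q p := [/\ reduced_tensor p, equiv p & forall v, tensor_inner p (iota v) = 0].
have [||U UP] := @vspace_of_pred C (tensor C m d) Q.
- split; first exact: reduced_tensor0.
    by rewrite -(linear0 iota); apply: iota_eq.
  by move=> v; rewrite (inner0l ipT).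
- move=> a p q [rp ep op] [rq eq oq]; split.
  + exact: reduced_tensor_linear.
  + exact: equiv_lin.
  + by move=> v; rewrite (inner_linear ipT) op oq mulr0 addr0.
have U_act g p : g \in unitmx -> p \in U -> tensor_act g p \in U.
  move=> gu /UP[rp ep op]; apply/UP; split.
  - exact: reduced_tensor_act.
  - by move=> b x bu xu bl; rewrite !tensor_eval_act -mulmxA ep // unitmx_mul xu.
  - move=> v; rewrite tensor_act_adjoint iota_act ?unitmx_adjoint //.
    by rewrite (innerZr ipT) op mulr0.
have [|k kU kP] := @riesz _ _ _ ipT U (fun p => tensor_eval p 1%:M).
  by move=> a p q; rewrite tensor_eval_linear.
have k_inv u : upper_unitriangular u -> tensor_act u k = k.
  move=> uu; have uut := unitmx_unitriangular uu.
  have dU : tensor_act u k - k \in U by rewrite memvB ?U_act.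
  apply/eqP; rewrite -subr_eq0; apply/eqP/(inner_definite ipT).
  have au : adjoint_mx u \in unitmx by rewrite unitmx_adjoint.
  rewrite (innerBr ipT) kP // -{2}[u]adjoint_mxK -tensor_act_adjoint.
  rewrite kP ?U_act // tensor_eval_act mul1mx -[adjoint_mx u]mulmx1.
  have /UP[_ eD _] := dU; rewrite eD ?unitmx1 //; last first.
  - by move=> i j ij; rewrite !mxE (upper_unitriangularW uu) ?conjC0.
  rewrite /chi weight_char_adjoint weight_char_unitriangular // det_adjoint_mx.
  rewrite det_upper_triangular; last exact: upper_unitriangularW.
  rewrite [\prod_i _]big1 => [|i _]; last by rewrite uu ?eqxx.
  by rewrite !conjC1 expr1n !mul1r subrr.
have Bv0 : B v0 v0 != 0 by apply: contra_neq v0n0; apply: (inner_definite ipB).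
pose c := tensor_eval k 1%:M / B v0 v0.
have Qk := (UP k).1 kU; case: Qk => rk ek ok.
have k_iota : k = c *: iota v0.
  apply: reduced_tensor_inj => // [|x xu].
    by rewrite -[_ *: _]addr0; apply: reduced_tensor_linear; last exact: reduced_tensor0.
  (* Both functions are left equivariant and right unitriangular invariant; [c]
     makes them agree at the identity. *)
  have diff0 : tensor_eval (- c *: iota v0 + k) x = 0.
    apply: (big_cell_vanishing (chi := chi)) => [|b bu bl|b g bu gu bl|u uu].
    - exact: polyfun_tensor_eval.
    - rewrite mulf_neq0 ?expf_neq0 //; first by apply: weight_char_neq0; [|left].
      by rewrite -unitfE -unitmxE.
    - exact: equiv_lin.
    have uut := unitmx_unitriangular uu.
    rewrite tensor_eval_linear iotaE // xiE.
    have -> : tensor_eval k u = tensor_eval k 1%:M.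
      by rewrite -{2}(k_inv u uu) tensor_eval_act mul1mx.
    rewrite wv0 //; last exact: upper_unitriangularW.
    rewrite weight_char_unitriangular // scale1r.
    rewrite det_upper_triangular; last exact: upper_unitriangularW.
    rewrite [\prod_i _]big1 => [|i _]; last by rewrite uu ?eqxx.
    by rewrite expr1n mulr1 mulNr divfK // addNr.
  move: diff0; rewrite tensor_eval_linear mulNr addrC => /subr0_eq ->.
  rewrite -[c *: iota v0]addr0 tensor_eval_linear.
  by rewrite [X in _ + X]big1 ?addr0 // => a _; rewrite ffunE mul0r.
have k0 : k = 0 by apply: (inner_definite ipT); rewrite {2}k_iota (innerZr ipT) ok mulr0.
have [A [F1 [FtA /memv_imgP[w _ Aw] ort]]] := orthogonal_decomposition ipT (limg iota) Ft.
have F1U : F1 \in U.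
  have F1E : F1 = -1 *: iota w + Ft by rewrite FtA Aw scaleN1r addKr.
  apply/UP; split; rewrite ?F1E; first exact: reduced_tensor_linear.
    exact: equiv_lin.
  move=> v; rewrite -F1E; apply: (inner_eq0_sym ipT); apply: ort.
  by apply: memv_img; apply: memvf.
exists w => g gu; have dg : \det g != 0 by rewrite -unitfE -unitmxE.
apply: (mulIf (expf_neq0 K dg)); rewrite -FtE // FtA Aw -xiE -iotaE //.
rewrite -[iota w]scale1r tensor_eval_linear mul1r -[F1 in LHS]scale1r.
have := kP _ (U_act g F1 gu F1U); rewrite k0 (inner0r ipT) tensor_eval_act mul1mx.
by rewrite !scale1r => <-; rewrite addr0.
Qed.

End WeightFunctions.

(** * Embedding [GL(n)] in [GL(n + 1)] *)

Notation widen i := (widen_ord (leqnSn _) i).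

Lemma last_ord_or_widen n (k : 'I_n.+1) :
  k = ord_max \/ exists i : 'I_n, k = widen i.
Proof.
have [kn|nk] := ltnP k n; first by right; exists (Ordinal kn); apply: val_inj.
by left; apply: val_inj; apply/eqP; rewrite eqn_leq nk -ltnS ltn_ord.
Qed.

Lemma widen_neq_max n (i : 'I_n) : (widen i == ord_max) = false.
Proof. by rewrite -val_eqE /= ltn_eqF. Qed.

Lemma max_neq_widen n (i : 'I_n) : (ord_max == widen i) = false.
Proof. by rewrite eq_sym widen_neq_max. Qed.

Lemma widen_eq n (i j : 'I_n) : (widen i == widen j) = (i == j).
Proof. by []. Qed.

Lemma unlift_widen n (i : 'I_n) : unlift ord_max (widen i) = Some i.
Proof.
have -> : widen i = lift ord_max i by apply: val_inj; apply/esym/lift_max.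
exact: liftK.
Qed.

Section Embedding.
Variables (C : fieldType) (n : nat).
Implicit Types (h : 'M[C]_n) (g : 'M[C]_n.+1).

Lemma GL_embedE h :
  [/\ forall i j, GL_embed h (widen i) (widen j) = h i j,
      forall i, GL_embed h (widen i) ord_max = 0,
      forall j, GL_embed h ord_max (widen j) = 0
    & GL_embed h ord_max ord_max = 1].
Proof.
have wE i : cast_ord (esym (addn1 n)) (widen i) = lshift 1 i by apply: val_inj.
have mE : cast_ord (esym (addn1 n)) ord_max = rshift n (ord0 : 'I_1).
  by apply: val_inj; rewrite /= addn0.
split=> [i j|i|j|]; rewrite castmxE ?wE ?mE.
- by rewrite block_mxEul.
- by rewrite block_mxEur mxE.
- by rewrite block_mxEdl mxE.
- by rewrite block_mxEdr mxE eqxx.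
Qed.

Lemma GL_embed_ww h i j : GL_embed h (widen i) (widen j) = h i j.
Proof. by case: (GL_embedE h). Qed.
Lemma GL_embed_wm h i : GL_embed h (widen i) ord_max = 0.
Proof. by case: (GL_embedE h). Qed.
Lemma GL_embed_mw h j : GL_embed h ord_max (widen j) = 0.
Proof. by case: (GL_embedE h). Qed.
Lemma GL_embed_mm h : GL_embed h ord_max ord_max = 1.
Proof. by case: (GL_embedE h). Qed.

Definition embedE := (GL_embed_ww, GL_embed_wm, GL_embed_mw, GL_embed_mm,
  widen_neq_max, max_neq_widen, widen_eq, eqxx, unlift_none, unlift_widen).

Lemma matrix_last_ind (g g' : 'M[C]_n.+1) :
  (forall i j, g (widen i) (widen j) = g' (widen i) (widen j)) ->
  (forall i, g (widen i) ord_max = g' (widen i) ord_max) ->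
  (forall j, g ord_max (widen j) = g' ord_max (widen j)) ->
  g ord_max ord_max = g' ord_max ord_max -> g = g'.
Proof.
move=> ww wm mw mm; apply/matrixP => i j.
by have [->|[i' ->]] := last_ord_or_widen i;
   have [->|[j' ->]] := last_ord_or_widen j.
Qed.

Lemma GL_embed_mulmx h h' : GL_embed (h *m h') = GL_embed h *m GL_embed h'.
Proof.
apply: matrix_last_ind => [i j|i|j|]; rewrite !mxE big_ord_recr /= !embedE.
- rewrite mxE mulr0 addr0; apply: eq_bigr => k _; by rewrite !embedE.
- by rewrite mul0r addr0 big1 // => k _; rewrite !embedE mulr0.
- by rewrite mulr0 addr0 big1 // => k _; rewrite !embedE mul0r.
- by rewrite mulr1 big1 ?add0r // => k _; rewrite !embedE mul0r.
Qed.

Lemma GL_embed1 : GL_embed 1%:M = 1%:M :> 'M[C]_n.+1.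
Proof.
by apply: matrix_last_ind => [i j|i|j|]; rewrite embedE !mxE ?embedE.
Qed.

Lemma det_GL_embed h : \det (GL_embed h) = \det h.
Proof.
rewrite /GL_embed; have -> : \det h = \det (block_mx h 0 0 (1%:M : 'M_1)).
  by rewrite det_ublock det1 mulr1.
by case: _ / (addn1 n) => /=; rewrite castmx_id.
Qed.

Lemma GL_embed_unit h : (GL_embed h \in unitmx) = (h \in unitmx).
Proof. by rewrite !unitmxE det_GL_embed. Qed.

Lemma GL_embed_upper h : upper_triangular h -> upper_triangular (GL_embed h).
Proof.
move=> hu i j; have [->|[i' ->]] := last_ord_or_widen i;
  have [->|[j' ->]] := last_ord_or_widen j; rewrite ?embedE //= ?ltnn //.
by apply: hu.
Qed.

Definition upper_left g : 'M[C]_n := \matrix_(i, j) g (widen i) (widen j).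

Lemma upper_leftK g :
  (forall i, g (widen i) ord_max = 0) -> (forall j, g ord_max (widen j) = 0) ->
  g ord_max ord_max = 1 -> GL_embed (upper_left g) = g.
Proof.
by move=> wm mw mm; apply: matrix_last_ind => [i j|i|j|]; rewrite embedE ?mxE.
Qed.

(** Unipotent matrices that differ from the identity in the last column only. The
    choice [y = 1] represents the open orbit of lower triangular matrices times upper
    triangular matrices of [GL(n)]: conjugation by the torus of [GL(n)] turns it
    into any other last column with nonzero entries. *)
Definition last_column (y : 'I_n -> C) : 'M[C]_n.+1 :=
  \matrix_(i, j) if j == ord_max then oapp y 1 (unlift ord_max i) else (i == j)%:R.

Lemma last_columnE y :
  [/\ forall i j, last_column y (widen i) (widen j) = (i == j)%:R,
      forall i, last_column y (widen i) ord_max = y i,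
      forall j, last_column y ord_max (widen j) = 0
    & last_column y ord_max ord_max = 1].
Proof.
by split=> *; rewrite mxE !embedE.
Qed.

Lemma last_column_upper y : upper_unitriangular (last_column y).
Proof.
have [ww wm mw mm] := last_columnE y.
move=> i j; have [->|[i' ->]] := last_ord_or_widen i;
  have [->|[j' ->]] := last_ord_or_widen j; rewrite ?(ww, mw, mm, embedE) //=.
by rewrite leqNgt ltn_ord.
Qed.

Lemma last_column_mul y g i j :
  (last_column y *m g) i j =
  (if i == ord_max then 0 else g i j) + oapp y 1 (unlift ord_max i) * g ord_max j.
Proof.
have [ww wm mw mm] := last_columnE y.
rewrite mxE big_ord_recr /=; have [->|[i' ->]] := last_ord_or_widen i.
  rewrite mm !embedE big1 // => k _; by rewrite mw mul0r.
rewrite wm !embedE /=; congr (_ + _); rewrite (bigD1 i') //= ww eqxx mul1r.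
rewrite big1 ?addr0 // => k /negPf ki; by rewrite ww eq_sym ki mul0r.
Qed.

Lemma unitriangular_factor u : upper_unitriangular u ->
  u = last_column (fun i => u (widen i) ord_max) *m GL_embed (upper_left u).
Proof.
move=> uu; apply/matrixP => i j; rewrite last_column_mul.
have [->|[i' ->]] := last_ord_or_widen i; have [->|[j' ->]] := last_ord_or_widen j.
- by rewrite !embedE mulr1 add0r uu ?eqxx.
- by rewrite !embedE mulr0 addr0 uu ?embedE // ltnW //= ltn_ord.
- by rewrite !embedE add0r mulr1.
- by rewrite !embedE mxE mulr0 addr0.
Qed.

Lemma upper_left_unitriangular u :
  upper_unitriangular u -> upper_unitriangular (upper_left u).
Proof. by move=> uu i j ji; rewrite mxE uu. Qed.

Definition torus (t : 'I_n -> C) : 'M[C]_n := diag_mx (\row_i t i).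

Lemma torusE t i j : torus t i j = t i *+ (i == j).
Proof. by rewrite /torus !mxE. Qed.

Lemma torus_upper t : upper_triangular (torus t).
Proof. by move=> i j ji; rewrite torusE -val_eqE /= gtn_eqF. Qed.

Lemma torus_lower t : lower_triangular (torus t).
Proof. by move=> i j ij; rewrite torusE -val_eqE /= ltn_eqF. Qed.

Lemma torus_unit t : (forall i, t i != 0) -> torus t \in unitmx.
Proof.
move=> t0; rewrite unitmxE unitfE det_upper_triangular; last exact: torus_upper.
by apply/prodf_neq0 => i _; rewrite torusE eqxx /= mulr1n t0.
Qed.

Lemma torus_mul t g i j :
  (GL_embed (torus t) *m g) i j = oapp t 1 (unlift ord_max i) * g i j.
Proof.
rewrite mxE big_ord_recr /=; have [->|[i' ->]] := last_ord_or_widen i.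
  by rewrite !embedE /= big1 ?add0r // => k _; rewrite embedE mul0r.
rewrite !embedE mul0r addr0 (bigD1 i') //= embedE torusE eqxx.
rewrite big1 ?addr0 // => k /negPf ki.
by rewrite embedE torusE eq_sym ki mul0r.
Qed.

Lemma last_column_torus (t : 'I_n -> C) :
  last_column t *m GL_embed (torus t) =
  GL_embed (torus t) *m last_column (fun=> 1).
Proof.
have [ww wm mw mm] := last_columnE (fun=> 1).
apply: matrix_last_ind => [i j|i|j|]; rewrite last_column_mul torus_mul;
  rewrite ?(ww, wm, mw, mm) !embedE ?torusE /= ?mulr0 ?addr0 ?add0r //.
by rewrite mulr_natr.
Qed.
End Embedding.

(** * The open orbit and the interlacing inequalities *)

Section SwappedMinor.
Variables (C : fieldType) (n : nat).
Implicit Types (h : 'M[C]_n) (g b u : 'M[C]_n.+1) (k : 'I_n).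

(** The minor on the first [k + 1] rows, where the last column has taken the
    place of column [k]. *)
Definition swapped_minor k g := leading_minor k.+1 (xcol (widen k) ord_max g).

Lemma swapped_minor_mull k g b : lower_triangular b ->
  swapped_minor k (b *m g) =
  (\prod_(i < n.+1 | (i < k.+1)%N) b i i) * swapped_minor k g.
Proof.
by move=> bl; rewrite /swapped_minor xcolE -mulmxA leading_minor_mull // xcolE.
Qed.

Lemma tperm_last k (j : 'I_n.+1) :
  tperm (widen k) ord_max j =
  if j == widen k then ord_max else if j == ord_max then widen k else j.
Proof. by case: tpermP => [->|->|/eqP/negPf-> /eqP/negPf->]; rewrite ?eqxx // max_neq_widen. Qed.

Lemma swapped_minor_mulr k g h : upper_triangular h ->
  swapped_minor k (g *m GL_embed h) =
  swapped_minor k g * \prod_(i < n | (i < k)%N) h i i.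
Proof.
move=> hu; have Hu := GL_embed_upper hu.
pose s := tperm (widen k) ord_max.
pose b := \matrix_(i, j) GL_embed h (s i) (s j).
have -> : swapped_minor k (g *m GL_embed h) =
    leading_minor k.+1 (xcol (widen k) ord_max g *m b).
  congr leading_minor; apply/matrixP => i j; rewrite !mxE.
  rewrite (reindex_inj (@perm_inj _ s)) /=; apply: eq_bigr => l _.
  by rewrite !mxE.
rewrite leading_minor_mulr => [|l j jk jl]; last first.
  rewrite mxE /s !tperm_last; have [jE|jnk] := eqVneq j (widen k).
    rewrite ifN; last by rewrite -val_eqE /= gtn_eqF // -[X in (X < _)%N]/(val (widen k)) -jE.
    have [lE|lnm] := eqVneq l ord_max; first by rewrite embedE.
    have [lE|[l' ->]] := last_ord_or_widen l; first by rewrite lE eqxx in lnm.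
    by rewrite embedE.
  have jk' : (j < k)%N by rewrite ltn_neqAle -ltnS jk andbT; move: jnk; rewrite -val_eqE.
  have jm : (j == ord_max) = false by rewrite -val_eqE /= ltn_eqF // (ltn_trans jk').
  rewrite jm; apply: Hu; case: ifP => _; first by rewrite /= (ltn_trans jk').
  by case: ifP.
congr (_ * _); rewrite (eq_bigl (fun i : 'I_n.+1 => (i < k.+1)%N)) //.
rewrite big_mkcond big_ord_recr /= ltnS leqNgt ltn_ord mulr1 [RHS]big_mkcond /=.
apply: eq_bigr => i _; rewrite mxE /s tperm_last widen_neq_max widen_eq ltnS.
have [->|ik] := eqVneq i k; first by rewrite leqnn ltnn embedE.
by rewrite embedE leq_eqVlt val_eqE (negPf ik).
Qed.

Lemma swapped_minor_eq0 k u : upper_unitriangular u ->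
  u (widen k) ord_max = 0 -> swapped_minor k u = 0.
Proof.
move=> uu uk; rewrite /swapped_minor /leading_minor (expand_det_row _ (widen k)).
apply: big1 => j _; rewrite !mxE ltnS leqnn /= tperm_last ltnS.
have [->|jk] := eqVneq j (widen k); first by rewrite leqnn uk mul0r.
case: leqP => [le_jk|lt_kj]; last by rewrite mul0r.
have -> : (j == ord_max) = false.
  by rewrite -val_eqE /= ltn_eqF // (leq_ltn_trans le_jk).
by rewrite uu //= eq_sym (negPf jk) mul0r.
Qed.

Lemma swapped_minor_last_column k : swapped_minor k (last_column (fun=> 1)) = 1.
Proof.
have [ww wm mw mm] := @last_columnE C n (fun=> 1).
rewrite /swapped_minor leading_minor_upper => [|l j lk jl].
  apply: big1 => i ik; rewrite mxE tperm_last.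
  have [->|_] := eqVneq i (widen k); first by rewrite wm.
  have -> : (i == ord_max) = false.
    by rewrite -val_eqE /= ltn_eqF // (leq_ltn_trans _ (ltn_ord k)).
  by rewrite last_column_upper // eqxx.
have jk : (j < k)%N by apply: leq_trans jl _; rewrite -ltnS.
have -> : xcol (widen k) ord_max (last_column (fun=> 1)) l j =
    last_column (fun=> 1 : C) l j.
  rewrite mxE tperm_last ifN; last by rewrite -val_eqE /= ltn_eqF.
  by rewrite ifN // -val_eqE /= ltn_eqF // (ltn_trans jk).
exact: (upper_unitriangularW (last_column_upper _)).
Qed.

Lemma polyfun_swapped_minor k : polyfun (swapped_minor k).
Proof.
apply: (polyfun_comp (polyfun_leading_minor C n.+1 k.+1)) => i j.
apply: polyfun_eq (polyfun_entry C i (tperm (widen k) ord_max j)) => x.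
by rewrite mxE.
Qed.

End SwappedMinor.

Lemma GL_embed_lower (C : fieldType) n (h : 'M[C]_n) :
  lower_triangular h -> lower_triangular (GL_embed h).
Proof.
move=> hu i j; have [->|[i' ->]] := last_ord_or_widen i;
  have [->|[j' ->]] := last_ord_or_widen j; rewrite ?embedE //= ?ltnn //.
by apply: hu.
Qed.

Section Spherical.
Variables (C : numFieldType) (n : nat).
Variables (lam : 'I_n.+1 -> int) (mu : 'I_n -> int) (f : 'M[C]_n.+1 -> C).
Hypothesis f_regular : regular_function f.
Hypothesis f_left : forall b g, b \in unitmx -> g \in unitmx ->
  lower_triangular b -> f (b *m g) = weight_char lam b * f g.
Hypothesis f_right : forall g h, g \in unitmx -> h \in unitmx ->
  upper_triangular h -> f (g *m GL_embed h) = weight_char mu h * f g.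
Local Notation g0 := (last_column (fun=> 1)).

Lemma last_column_unit (y : 'I_n -> C) : last_column y \in unitmx.
Proof. exact/unitmx_unitriangular/last_column_upper. Qed.

Lemma last_column_value (t : 'I_n -> C) : (forall i, t i != 0) ->
  weight_char mu (torus t) * f (last_column t) =
  weight_char lam (GL_embed (torus t)) * f g0.
Proof.
move=> t0; have tu := torus_unit t0.
rewrite -f_right ?last_column_unit //; last exact: torus_upper.
rewrite last_column_torus f_left ?last_column_unit ?GL_embed_unit //.
exact/GL_embed_lower/torus_lower.
Qed.

(** The nonvanishing of the minors that define [D] puts [x] into the orbit of [g0]
    under lower triangular matrices and upper triangular matrices of [GL(n)]. *)
Lemma spherical_vanishing : f g0 = 0 -> forall g, g \in unitmx -> f g = 0.
Proof.
move=> f0; have [k [P [PP fE]]] := regular_polyfun f_regular.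
suff P0 x : P x = 0 by move=> g gu; rewrite fE // P0 mul0r.
apply: (polyfun_density (g0 := g0) (D := fun x => \det x *
    ((\prod_(k < n.+1) leading_minor k.+1 x) * \prod_(k < n) swapped_minor k x))) => //.
- apply: polyfunM; first exact: polyfun_det_id.
  apply: polyfunM; first by apply: polyfun_prod => i; apply: polyfun_leading_minor.
  by apply: polyfun_prod => i; apply: polyfun_swapped_minor.
- have gu := @last_column_upper C n (fun=> 1).
  rewrite mulf_neq0 //; first by have := last_column_unit (fun=> 1); rewrite unitmxE unitfE.
  rewrite mulf_neq0 //; apply/prodf_neq0 => i _; last by rewrite swapped_minor_last_column oner_eq0.
  rewrite leading_minor_upper => [|l j _ jl]; last exact: (upper_unitriangularW gu).
  by rewrite big1 ?oner_eq0 // => l _; rewrite gu ?eqxx.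
move=> {}x; rewrite !mulf_eq0 !negb_or => /and3P[dx /prodf_neq0 lx /prodf_neq0 sx].
have xu : x \in unitmx by rewrite unitmxE unitfE.
suff fx : f x = 0.
  have := fE x xu; rewrite fx => /esym/eqP.
  by rewrite mulf_eq0 invr_eq0 expf_eq0 (negPf dx) andbF orbF => /eqP.
have [|b [bl bu uu]] := @lower_mul_unitriangular _ _ x; first by move=> i; apply: lx.
apply: (mulfI (weight_char_neq0 lam bu (or_introl bl))); rewrite mulr0 -f_left //.
rewrite (unitriangular_factor uu); set y := fun i => _.
have y0 i : y i != 0.
  have : swapped_minor i (b *m x) != 0.
    rewrite swapped_minor_mull // mulf_neq0 ?sx //.
    by apply/prodf_neq0 => j _; apply: diag_unit_neq0 => //; left.
  by apply: contra_neq => yi; apply: swapped_minor_eq0.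
have Au := upper_left_unitriangular uu.
rewrite f_right ?last_column_unit ?unitmx_unitriangular //; last exact: upper_unitriangularW.
suff -> : f (last_column y) = 0 by rewrite mulr0.
have /(mulfI (weight_char_neq0 mu (torus_unit y0) (or_intror (torus_upper y)))) :
  weight_char mu (torus y) * f (last_column y) = weight_char mu (torus y) * 0.
  by rewrite last_column_value // f0 !mulr0.
by [].
Qed.

Lemma prod_single (m : nat) (k : 'I_m) (F : 'I_m -> C) :
  (forall i, i != k -> F i = 1) -> \prod_i F i = F k.
Proof. by move=> F1; rewrite (bigD1 k) //= big1 ?mulr1. Qed.

(** The source of the inequalities: [f] has no pole on a line of matrices of
    determinant one, even at the point [s = 0] outside the open orbit. *)
Lemma line_exponent_ge0 (x y : 'M[C]_n.+1) (e : int) c : c != 0 ->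
  (forall s, s != 0 -> \det (x + s *: y) = 1 /\ f (x + s *: y) = s ^ e * c) ->
  0 <= e.
Proof.
move=> c0 line; have [k [P [PP fE]]] := regular_polyfun f_regular.
have [q qE] := polyfun_line x y PP.
apply: (monomial_exponent_ge0 c0 (q := q)) => s s0.
have [d1 <-] := line s s0.
by rewrite fE ?d1 ?expr1n ?divr1 ?qE // unitmxE d1 unitr1.
Qed.

(** The line varies one entry of the last column of the base point; conjugation by
    a torus of [GL(n)] brings it back to the base point. *)
Lemma spherical_upper_bound k : f g0 != 0 -> mu k <= lam (widen k).
Proof.
move=> f0; rewrite -subr_ge0.
pose t s (i : 'I_n) : C := if i == k then s else 1.
apply: (@line_exponent_ge0 (last_column (t 0)) (delta_mx (widen k) ord_max) _ _ f0).
move=> s s0.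
have -> : last_column (t 0) + s *: delta_mx (widen k) ord_max = last_column (t s).
  apply: matrix_last_ind => [i j|i|j|]; rewrite !mxE !embedE /= ?andbF ?mulr0 ?addr0 //.
  rewrite /t andbT; case: (i == k); by rewrite ?add0r ?mulr1 ?mulr0 ?addr0.
have t0 i : t s i != 0 by rewrite /t; case: ifP => _ //; apply: oner_neq0.
split.
  rewrite det_upper_triangular; last exact/upper_unitriangularW/last_column_upper.
  by apply: big1 => i _; rewrite last_column_upper ?eqxx.
have := last_column_value t0.
have -> : weight_char mu (torus (t s)) = s ^ mu k.
  rewrite /weight_char (prod_single (k := k)) => [|i /negPf ik].
    by rewrite torusE eqxx /t eqxx.
  by rewrite torusE eqxx /t ik exp1rz.
have -> : weight_char lam (GL_embed (torus (t s))) = s ^ lam (widen k).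
  rewrite /weight_char (prod_single (k := widen k)) => [|i].
    by rewrite embedE torusE eqxx /t eqxx.
  have [->|[i' ->]] := last_ord_or_widen i; rewrite !embedE ?exp1rz //.
  by rewrite torusE eqxx /t => /negPf->; rewrite exp1rz.
move=> E; apply: (mulfI (expfz_neq0 (mu k) s0)); rewrite E mulrA -expfzDr //.
by rewrite subrKC.
Qed.

(** On the line [x = x0 + s *: delta_mx k k], the leading minor of size [k + 1]
    equals [s] and all other leading and swapped minors are constant. The matrices
    [b] and [Y] perform row and column operations, the latter inside [GL(n)], that
    carry the line to the base point. *)
Lemma spherical_lower_bound k : f g0 != 0 -> lam (lift ord0 k) <= mu k.
Proof.
move=> f0; rewrite -subr_ge0.
set k1 := lift ord0 k; pose k0 : 'I_n.+1 := widen k.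
have k1E : nat_of_ord k1 = k.+1 by [].
have k01 : (k0 == k1) = false by rewrite -val_eqE /= /bump /= add1n ltn_eqF.
have k10 : (k1 == k0) = false by rewrite eq_sym.
have k0m : (k0 == ord_max) = false by exact: widen_neq_max.
have mk0 : (ord_max == k0) = false by exact: max_neq_widen.
pose b s : 'M[C]_n.+1 := \matrix_(i, j)
  if i == k1 then (if j == k1 then s else (j == k0)%:R) else (i == j)%:R.
pose Y s : 'M[C]_n.+1 := \matrix_(i, j)
  if i == k0 then (if j == k0 then s else ((j == k1) && (k1 != ord_max))%:R)
  else (i == j)%:R.
pose x0 : 'M[C]_n.+1 := \matrix_(i, j)
  if i == k0 then ((j == k1) || (j == ord_max))%:R
  else if i == k1 then - (j == k0)%:R else ((i == j) || (j == ord_max))%:R.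
apply: (@line_exponent_ge0 x0 (delta_mx k0 k0) _ _ f0) => s s0.
set x := x0 + _.
have b_lower : lower_triangular (b s).
  move=> i j ij; rewrite mxE; have [iE|_] := eqVneq i k1.
    rewrite ifN; last by rewrite -iE -val_eqE /= gtn_eqF.
    by rewrite -val_eqE /= gtn_eqF // ltnW // -k1E -iE.
  by rewrite -val_eqE /= ltn_eqF.
have Y_upper : upper_triangular (Y s).
  move=> i j ji; rewrite mxE; have [iE|_] := eqVneq i k0.
    rewrite ifN; last by rewrite -iE -val_eqE /= ltn_eqF.
    have jk : (j < k)%N by rewrite iE in ji.
    by rewrite -val_eqE /= /bump /= add1n ltn_eqF // ltnS ltnW.
  by rewrite -val_eqE /= gtn_eqF.
have bii i : b s i i = if i == k1 then s else 1.
  by rewrite mxE eqxx; case: (i == k1).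
have Yii i : Y s i i = if i == k0 then s else 1.
  by rewrite mxE eqxx; case: (i == k0).
have det_b : \det (b s) = s.
  rewrite det_trig; last exact/is_trig_mxP.
  by rewrite (prod_single (k := k1)) => [|i /negPf ik]; rewrite bii ?eqxx ?ik.
have det_Y : \det (Y s) = s.
  rewrite det_upper_triangular //.
  by rewrite (prod_single (k := k0)) => [|i /negPf ik]; rewrite Yii ?eqxx ?ik.
have YE : GL_embed (upper_left (Y s)) = Y s.
  apply: upper_leftK => [i|j|]; rewrite mxE.
  - rewrite mk0 widen_neq_max; case: ifP => // _.
    by rewrite eq_sym; case: eqP.
  - by rewrite mk0 max_neq_widen.
  - by rewrite mk0 eqxx.
have bxY : b s *m x = g0 *m Y s.
  apply/matrixP => i j; rewrite last_column_mul.
  have -> : oapp (fun=> 1) 1 (unlift ord_max i) = 1 :> C by case: unlift.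
  have bx i' : (b s *m x) i' j = if i' == k1 then x k0 j + s * x k1 j else x i' j.
    rewrite mxE; case: eqVneq => [->|ik].
      rewrite (bigD1 k0) //= (bigD1 k1) /=; last by rewrite k10.
      rewrite [b s k1 k0]mxE [b s k1 k1]mxE !eqxx k01 mul1r.
      rewrite big1 ?addr0 // => l /andP[/negPf lk0 /negPf lk1].
      by rewrite mxE eqxx lk1 lk0 mul0r.
    rewrite (bigD1 i') //= [b s i' i']mxE (negPf ik) eqxx mul1r.
    rewrite big1 ?addr0 // => l /negPf li.
    by rewrite mxE (negPf ik) eq_sym li mul0r.
  have xE i' : x i' j = x0 i' j + s * ((i' == k0) && (j == k0))%:R.
    by rewrite !mxE.
  rewrite bx !xE !mxE mk0 !eqxx k10 /= mul1r [ord_max == j]eq_sym.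
  have [->|ik1] := eqVneq i k1.
    rewrite k10 mulr0 addr0 mulrN addrK [k1 == j]eq_sym.
    have [k1m|k1m] := eqVneq k1 ord_max; first by rewrite k1m orbb add0r.
    have [->|_] := eqVneq j k1; last by rewrite add0r.
    by rewrite (negPf k1m) addr0.
  have [->|ik0] := eqVneq i k0.
    rewrite k0m /=; have [->|jk0] := eqVneq j k0.
      by rewrite k01 k0m mulr1 add0r addr0.
    rewrite mulr0 addr0; have [->|jk1] /= := eqVneq j k1; last by rewrite add0r.
    by case: (k1 == ord_max); rewrite ?add0r ?addr0.
  rewrite mulr0 addr0; have [->|im] := eqVneq i ord_max.
    by rewrite add0r [ord_max == j]eq_sym orbb.
  have [->|jm] := eqVneq j ord_max; last by rewrite orbF addr0.
  by rewrite (negPf im) add0r.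
have bu : b s \in unitmx by rewrite unitmxE unitfE det_b.
have Yu : upper_left (Y s) \in unitmx by rewrite -GL_embed_unit YE unitmxE unitfE det_Y.
have detx : \det x = 1.
  apply: (mulfI s0); rewrite -{1}det_b -det_mulmx bxY det_mulmx det_Y mulr1.
  rewrite det_upper_triangular; last exact/upper_unitriangularW/last_column_upper.
  by rewrite big1 ?mul1r // => i _; rewrite last_column_upper ?eqxx.
split=> //; have xu : x \in unitmx by rewrite unitmxE detx unitr1.
have := f_left bu xu b_lower; rewrite bxY -YE f_right ?last_column_unit //; last first.
  by move=> i j ji; rewrite mxE Y_upper.
have -> : weight_char lam (b s) = s ^ lam k1.
  rewrite /weight_char (prod_single (k := k1)) => [|i /negPf ik]; rewrite bii ?eqxx //.
  by rewrite ik exp1rz.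
have -> : weight_char mu (upper_left (Y s)) = s ^ mu k.
  rewrite /weight_char (prod_single (k := k)) => [|i /negPf ik]; rewrite mxE Yii ?eqxx //.
  by rewrite widen_eq ik exp1rz.
move=> E; apply: (mulfI (expfz_neq0 (lam k1) s0)); rewrite -E mulrA -expfzDr //.
by rewrite subrKC.
Qed.

End Spherical.

(** * The interlacing weights occur *)

Lemma extend_ord (T : Type) (x0 : T) n (f : 'I_n -> T) :
  exists2 f' : nat -> T, forall i : 'I_n, f i = f' i &
    forall k, f' k = x0 \/ exists i, f' k = f i.
Proof.
exists (fun k => oapp f x0 (insub k)) => [i|k]; first by rewrite valK.
by case: insub => [i|] /=; [right; exists i | left].
Qed.

Section Telescope.
Variables (C : fieldType) (a : nat -> C) (l m : nat -> int).
Hypothesis a0 : forall i, a i != 0.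
Local Notation p k := (\prod_(i < k) a i).

Lemma prod_ord_neq0 k : p k != 0.
Proof. by apply/prodf_neq0 => i _; apply: a0. Qed.

(** The weight of [spherical_function] under lower triangular matrices with diagonal
    [a]. *)
Lemma telescope_rows n :
  (\prod_(k < n) (p k.+1 ^ (m k - l k.+1) * p k.+1 ^ (l k - m k)))
    * p n.+1 ^ l n = \prod_(i < n.+1) a i ^ l i.
Proof.
elim: n => [|n IH]; first by rewrite big_ord0 mul1r !big_ord1.
rewrite [RHS]big_ord_recr /= -IH [X in X * _ = _]big_ord_recr /= -!mulrA; congr (_ * _).
have -> : p n.+2 = p n.+1 * a n.+1 by rewrite big_ord_recr.
have := prod_ord_neq0 n.+1; move: (p n.+1) => q q0.
rewrite expfzMl !mulrA -!expfzDr //; congr (_ ^ _ * _).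
by rewrite addrAC subrK addrC subrK.
Qed.

(** The weight of [spherical_function] under upper triangular matrices of [GL(n)] with
    diagonal [a]; a swapped minor sees one diagonal entry less. *)
Lemma telescope_columns n :
  (\prod_(k < n) (p k.+1 ^ (m k - l k.+1) * p k ^ (l k - m k)))
    * p n ^ l n = \prod_(i < n) a i ^ m i.
Proof.
elim: n => [|n IH]; first by rewrite !big_ord0 mul1r exp1rz.
rewrite [RHS]big_ord_recr /= -IH big_ord_recr /= -!mulrA; congr (_ * _).
rewrite mulrCA -expfzDr ?prod_ord_neq0 // subrK.
have -> : p n.+1 = p n * a n by rewrite big_ord_recr.
by rewrite expfzMl mulrA -expfzDr ?prod_ord_neq0 // subrK.
Qed.

End Telescope.

Section ExtremalFunction.
Variables (C : numFieldType) (n : nat).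
Variables (lam : 'I_n.+1 -> int) (mu : 'I_n -> int).

(** The equivariance under lower triangular matrices on the left and upper triangular
    matrices of [GL(n)] on the right determines a function on the open orbit up to a
    scalar. This is the solution; it is regular on the whole group when the
    exponents of the minors are nonnegative, that is, under interlacing. *)
Definition spherical_function (g : 'M[C]_n.+1) : C :=
  (\prod_(k < n) (leading_minor k.+1 g ^ (mu k - lam (lift ord0 k)) *
                  swapped_minor k g ^ (lam (widen k) - mu k)))
  * \det g ^ lam ord_max.

Lemma polyfunXz m (f : 'M[C]_m -> C) (e : int) :
  0 <= e -> polyfun f -> polyfun (fun x => f x ^ e).
Proof. by case: e => // e _; apply: polyfunX. Qed.

Lemma spherical_function_regular :
  interlacing lam mu -> regular_function spherical_function.
Proof.
move=> inter; pose P (g : 'M[C]_n.+1) :=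
  \prod_(k < n) (leading_minor k.+1 g ^ (mu k - lam (lift ord0 k)) *
                  swapped_minor k g ^ (lam (widen k) - mu k)).
have PP : polyfun P.
  apply: polyfun_prod => k; have [le_mu le_lam] := inter k.
  apply: polyfunM; apply: polyfunXz; rewrite ?subr_ge0 //.
    exact: polyfun_leading_minor.
  exact: polyfun_swapped_minor.
rewrite /spherical_function; case: (lam ord_max) => e.
  apply: (polyfun_regular (k := 0) (P := fun g => P g * \det g ^+ e)).
    by apply: polyfunM PP (polyfunX _ (polyfun_det_id _ _)).
  by move=> g _; rewrite divr1.
by apply: (polyfun_regular (k := e.+1) PP) => g _; rewrite NegzE -exprnN.
Qed.

Lemma spherical_function_left b g : b \in unitmx -> g \in unitmx ->
  lower_triangular b ->
  spherical_function (b *m g) = weight_char lam b * spherical_function g.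
Proof.
move=> bu gu bl.
have [l lE _] := extend_ord 0 lam; have [m mE _] := extend_ord 0 mu.
have [a aE aP] := extend_ord 1 (fun i => b i i).
have a0 i : a i != 0.
  case: (aP i) => [->|[j ->]]; first exact: oner_neq0.
  by apply: diag_unit_neq0; last left.
have pE (k : 'I_n) : \prod_(i < n.+1 | (i < k.+1)%N) b i i = \prod_(i < k.+1) a i.
  rewrite (big_ord_widen n.+1 a); last exact: (ltnW (ltn_ord k)).
  by apply: eq_bigr => i _; rewrite aE.
have detE : \det b = \prod_(i < n.+1) a i.
  by rewrite det_trig; [apply: eq_bigr => i _; rewrite aE | apply/is_trig_mxP].
have -> : weight_char lam b = \prod_(i < n.+1) a i ^ l i.
  by apply: eq_bigr => i _; rewrite aE lE.
rewrite -(telescope_rows l m a0) /spherical_function det_mulmx detE expfzMl lE.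
rewrite mulrACA -big_split /=; congr (_ * _); apply: eq_bigr => k _.
rewrite leading_minor_mull // swapped_minor_mull // pE !expfzMl !lE mE.
by rewrite /= mulrACA.
Qed.

Lemma spherical_function_right g h : g \in unitmx -> h \in unitmx ->
  upper_triangular h ->
  spherical_function (g *m GL_embed h) = weight_char mu h * spherical_function g.
Proof.
move=> gu hu ht.
have [l lE _] := extend_ord 0 lam; have [m mE _] := extend_ord 0 mu.
have [a aE aP] := extend_ord 1 (fun i => h i i).
have a0 i : a i != 0.
  case: (aP i) => [->|[j ->]]; first exact: oner_neq0.
  by apply: diag_unit_neq0; last right.
have pE k : (k <= n)%N -> \prod_(i < n | (i < k)%N) h i i = \prod_(i < k) a i.
  move=> kn; rewrite (big_ord_widen n a) //.
  by apply: eq_bigr => i _; rewrite aE.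
have detE : \det h = \prod_(i < n) a i.
  by rewrite det_upper_triangular //; apply: eq_bigr => i _; rewrite aE.
have leadE (k : 'I_n) : leading_minor k.+1 (g *m GL_embed h) =
    leading_minor k.+1 g * \prod_(i < k.+1) a i.
  rewrite leading_minor_mulr => [|i j _ ji]; last exact: (GL_embed_upper ht).
  rewrite -pE //; congr (_ * _).
  rewrite [LHS]big_mkcond [RHS]big_mkcond big_ord_recr /= ltnS leqNgt ltn_ord mulr1.
  by apply: eq_bigr => i _; rewrite embedE.
have -> : weight_char mu h = \prod_(i < n) a i ^ m i.
  by apply: eq_bigr => i _; rewrite aE mE.
rewrite -(telescope_columns l m a0) /spherical_function det_mulmx det_GL_embed.
rewrite detE expfzMl lE [X in _ * X = _]mulrC mulrACA -big_split /=.
congr (_ * _); apply: eq_bigr => k _.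
rewrite leadE swapped_minor_mulr // pE ?(ltnW (ltn_ord k)) // !expfzMl !lE mE.
by rewrite mulrACA mulrC.
Qed.

End ExtremalFunction.

Lemma spherical_function_base (C : numFieldType) n lam mu :
  @spherical_function C n lam mu (last_column (fun=> 1)) = 1.
Proof.
have gu := @last_column_upper C n (fun=> 1).
have gut := upper_unitriangularW gu.
have lead k : leading_minor k (@last_column C n (fun=> 1)) = 1.
  rewrite leading_minor_upper => [|l j _ jl]; last exact: gut.
  by apply: big1 => i _; rewrite gu ?eqxx.
rewrite /spherical_function -leading_minor_full lead exp1rz mulr1.
by apply: big1 => k _; rewrite lead swapped_minor_last_column !exp1rz mulr1.
Qed.

(** * Restriction, complete reducibility and highest weights *)

Lemma restriction_rational (C : fieldType) n (V : vectType C)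
    (rho : 'M[C]_n.+1 -> 'End(V)) :
  rational_representation rho -> rational_representation (restriction rho).
Proof.
move=> [rho1 rhoM rhoreg]; split=> [|g h gu hu|phi v].
- by rewrite /restriction GL_embed1.
- by rewrite /restriction GL_embed_mulmx rhoM ?GL_embed_unit.
have [k [P [PP PE]]] := regular_polyfun (rhoreg phi v).
apply: (polyfun_regular (k := k) (P := fun g => P (GL_embed g))).
  apply: polyfun_comp PP _ => i j.
  have [->|[i' ->]] := last_ord_or_widen i; have [->|[j' ->]] := last_ord_or_widen j.
  - by apply: polyfun_eq (polyfun_const n (1 : C)) => x; rewrite embedE.
  - by apply: polyfun_eq (polyfun_const n (0 : C)) => x; rewrite embedE.
  - by apply: polyfun_eq (polyfun_const n (0 : C)) => x; rewrite embedE.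
  - by apply: polyfun_eq (polyfun_entry C i' j') => x; rewrite embedE.
by move=> g gu; rewrite /restriction PE ?GL_embed_unit // det_GL_embed.
Qed.

Lemma restriction_contravariant (C : numClosedFieldType) n (V : vectType C)
    (rho : 'M[C]_n.+1 -> 'End(V)) B :
  contravariant rho B -> contravariant (restriction rho) B.
Proof.
move=> conB g gu v w; rewrite /restriction conB ?GL_embed_unit //.
congr (B v (rho _ w)).
apply: matrix_last_ind => [i j|i|j|]; rewrite !mxE !embedE ?conjC0 ?conjC1 //.
by rewrite !mxE.
Qed.

(** A nonzero invariant subspace of least dimension is irreducible, and its
    orthogonal complement is invariant because the group is stable under conjugate transpose. *)
Lemma complete_reducibility (C : numClosedFieldType) m (V : vectType C)
    (sigma : 'M[C]_m -> 'End(V)) B :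
  inner_product B -> contravariant sigma B ->
  exists r (U : 'I_r -> {vspace V}), irreducible_decomposition sigma U.
Proof.
move=> ipB conB.
suff H d (X : {vspace V}) : (\dim X < d)%N -> invariant_subspace sigma X ->
    exists r (U : 'I_r -> {vspace V}), [/\ directv (\sum_(i < r) U i),
      (\sum_(i < r) U i)%VS = X & forall i, irreducible_subspace sigma (U i)].
  by apply: (H (\dim {:V}).+1 fullv) => // g _; apply: subvf.
elim: d X => // d IH X; rewrite ltnS => dX Xinv.
have [X0|X0] := eqVneq X 0%VS.
  exists 0%N, (fun=> 0%VS); split=> [||[]//]; last by rewrite big_ord0 X0.
  by rewrite directvE /= !big_ord0 dimv0.
pose Q k := `[< exists U : {vspace V}, [/\ invariant_subspace sigma U,
  (U <= X)%VS, U != 0%VS & \dim U = k] >].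
have exQ : exists k, Q k by exists (\dim X); apply/asboolP; exists X.
case: (ex_minnP exQ) => k /asboolP[U [Uinv UX U0 dU]] Umin.
have Uirr : irreducible_subspace sigma U.
  split=> // W Winv WU; have [|W0] := eqVneq W 0%VS; [by left | right].
  apply/eqP; rewrite eqEdim WU dU; apply/Umin/asboolP; exists W; split=> //.
  exact: subv_trans WU UX.
have [||Y YP] := @vspace_of_pred C V (fun v => v \in X /\ forall u, u \in U -> B u v = 0).
- by split=> [|u _]; rewrite ?mem0v ?(inner0r ipB).
- move=> a x y [xX xU] [yX yU]; split=> [|u uU]; first by rewrite memvD ?memvZ.
  by rewrite (innerDr ipB) (innerZr ipB) xU ?yU // mulr0 addr0.
have YX : (Y <= X)%VS by apply/subvP => v /YP[].
have Yinv : invariant_subspace sigma Y.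
  move=> g gu; apply/subvP => _ /memv_imgP[v /YP[vX vU] ->]; apply/YP; split.
    by apply: (subvP (Xinv g gu)); apply: memv_img.
  move=> u uU; rewrite -[g]adjoint_mxK -conB ?unitmx_adjoint //; apply: vU.
  have au : adjoint_mx g \in unitmx by rewrite unitmx_adjoint.
  by apply: (subvP (Uinv _ au)); apply: memv_img.
have UY0 : (U :&: Y = 0)%VS.
  apply/eqP; rewrite -subv0; apply/subvP => v /memv_capP[vU /YP[_ vo]].
  by rewrite memv0; apply/eqP/(inner_definite ipB); apply: vo.
have UYX : (U + Y)%VS = X.
  apply/eqP; rewrite eqEsubv subv_add UX YX /=; apply/subvP => v vX.
  have [u [w [vE uU wo]]] := orthogonal_decomposition ipB U v.
  rewrite vE memv_add //; apply/YP; split=> //.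
  have -> : w = v - u by rewrite vE addrC addKr.
  by rewrite memvB // (subvP UX).
have ltY : (\dim Y < d)%N.
  apply: leq_trans dX; rewrite -UYX dimv_disjoint_sum // -[X in (X < _)%N]add0n.
  by rewrite ltn_add2r lt0n dimv_eq0.
have [r [T [Tdir TE Tirr]]] := IH Y ltY Yinv.
exists r.+1, (fun i => oapp T U (unlift ord0 i)); split=> [||i].
- rewrite directvE /= !big_ord_recl unlift_none /=.
  under eq_bigr => i _ do rewrite liftK /=.
  under [X in _ == (_ + X)%N]eq_bigr => i _ do rewrite liftK /=.
  by rewrite TE dimv_disjoint_sum // -{1}TE (directvP Tdir).
- rewrite big_ord_recl unlift_none /=.
  by under eq_bigr => i _ do rewrite liftK /=; rewrite TE.
by case: unliftP => [j _|_] /=.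
Qed.

(** Both sides embed into functions on the group through their coefficients at
    the highest weight vector; every coefficient function of [W] is one of [V], and the
    component in [U] of the vector giving it is unique. *)
Lemma isomorphic_of_weight_vector (C : numClosedFieldType) m (V W : vectType C)
    (sigma : 'M[C]_m -> 'End(V)) (tau : 'M[C]_m -> 'End(W)) B
    (U : {vspace V}) mu u w0 :
  rational_representation sigma -> inner_product B -> contravariant sigma B ->
  irreducible_subspace sigma U -> u \in U -> u != 0 ->
  weight_vector sigma mu u ->
  irreducible_representation tau -> w0 != 0 -> weight_vector tau mu w0 ->
  isomorphic_to_subspace sigma tau U.
Proof.
move=> srat ipB conB Uirr uU u0 uw [trat tirr] w00 ww.
have [A ipA conA] := contravariant_inner_product (conj trat tirr).
have [Uinv _ Umin] := Uirr; have [s1 _ _] := srat; have [t1 _ _] := trat.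
have sU g x : g \in unitmx -> x \in U -> sigma g x \in U.
  by move=> gu xU; apply: (subvP (Uinv g gu)); apply: memv_img.
pose Rel w x := x \in U /\ forall g, g \in unitmx -> A (tau g w) w0 = B (sigma g x) u.
have Rlin a w w' x x' : Rel w x -> Rel w' x' -> Rel (a *: w + w') (a *: x + x').
  move=> [xU xE] [x'U x'E]; split; first by rewrite memvD ?memvZ.
  move=> g gu; rewrite !linearP (inner_linear ipA) (inner_linear ipB).
  by rewrite xE ?x'E.
have R0 : Rel 0 0.
  by split=> [|g gu]; rewrite ?mem0v // !linear0 (inner0l ipA) (inner0l ipB).
have Rtot w : exists x, Rel w x.
  have [|b g bu gu bl|x xE] := coefficient_of_equivariant srat ipB conB uw u0
    (F := fun g => A (tau g w) w0).
  - exact: coefficient_regular.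
  - exact: (coefficient_equivariant trat ipA conA ww).
  have [y [z [xyz yU zo]]] := orthogonal_decomposition ipB U x.
  exists y; split=> // g gu; rewrite xE // xyz linearD (innerDl ipB).
  rewrite [B (sigma g z) u]conB // (inner_conj ipB _ z) zo ?conjC0 ?addr0 //.
  by apply: sU; rewrite ?unitmx_adjoint.
have Rinj w x x' : Rel w x -> Rel w x' -> x = x'.
  move=> [xU xE] [x'U x'E]; apply/eqP; rewrite -subr_eq0; apply/eqP.
  apply: (@irreducible_pred0 _ _ _ sigma U (fun y => forall g, g \in unitmx ->
    B (sigma g y) u = 0) u Uirr).
  - by move=> g _; rewrite linear0 (inner0l ipB).
  - move=> a y z yP zP g gu; rewrite linearP (inner_linear ipB).
    by rewrite yP ?zP // mulr0 addr0.
  - by move=> h hu y yP g gu; rewrite representationV // yP // unitmx_mul gu.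
  - exact: uU.
  - move=> /(_ 1%:M (unitmx1 _ _)); rewrite s1 id_lfunE => /(inner_definite ipB).
    by move/eqP: u0.
  - by rewrite memvB.
  by move=> g gu; rewrite linearB (innerBl ipB) -xE // -x'E // subrr.
have [|i|f fP] := linear_map_of_rel Rlin; [exact: R0 | exact: Rtot |].
have f_eq g w : g \in unitmx -> f (tau g w) = sigma g (f w).
  move=> gu; apply: (Rinj (tau g w)) (fP _) _; have [fU fE] := fP w.
  split; first exact: sU.
  by move=> h hu; rewrite !representationV // fE // unitmx_mul hu.
have f0 w : f w = 0 -> w = 0.
  move=> fw; apply: (@irreducible_pred0 _ _ _ tau fullv (fun y => f y = 0) w0 tirr).
  - exact: linear0.
  - by move=> a y z yP zP; rewrite linearP /= yP zP scaler0 addr0.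
  - by move=> g gu y yP; rewrite f_eq // yP linear0.
  - exact: memvf.
  - move=> fw0; have [_ /(_ 1%:M (unitmx1 _ _))] := fP w0.
    rewrite fw0 linear0 (inner0l ipB) t1 id_lfunE => /(inner_definite ipA).
    by move/eqP: w00.
  - exact: memvf.
  exact: fw.
exists f; split; last by move=> g gu w; apply: f_eq.
  by apply/eqP; rewrite -subv0; apply/subvP => w; rewrite memv_ker memv0 => /eqP/f0->.
have [||im0|//] := Umin (limg f).
- move=> g gu; apply/subvP => _ /memv_imgP[_ /memv_imgP[w _ ->] ->].
  by rewrite -f_eq // memv_img ?memvf.
- by apply/subvP => _ /memv_imgP[w _ ->]; case: (fP w).
have : f w0 \in limg f by rewrite memv_img ?memvf.
by rewrite im0 memv0 => /eqP/f0/eqP; rewrite (negPf w00).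
Qed.

(** * The branching rule *)

Section Branching.
Variables (C : numClosedFieldType) (n : nat) (V : vectType C).
Variables (rho : 'M[C]_n.+1 -> 'End(V)) (lam : 'I_n.+1 -> int) (v0 : V).
Variables (B : V -> V -> C) (mu : 'I_n -> int).
Hypotheses (rat : rational_representation rho)
  (irr : irreducible_subspace rho fullv).
Hypotheses (ipB : inner_product B) (conB : contravariant rho B).
Hypotheses (v0n0 : v0 != 0) (wv0 : weight_vector rho lam v0).
Local Notation coef v := (fun g => B (rho g v) v0).
Local Notation g0 := (last_column (fun=> 1)).

Lemma coefficient_inj v :
  (forall g, g \in unitmx -> coef v g = 0) -> v = 0.
Proof.
have [rho1 _ _] := rat.
apply: (@irreducible_pred0 _ _ _ rho fullv
  (fun v => forall g, g \in unitmx -> coef v g = 0) v0 irr).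
- by move=> g _; rewrite linear0 (inner0l ipB).
- move=> a x y xP yP g gu; rewrite linearP (inner_linear ipB).
  by rewrite xP ?yP // mulr0 addr0.
- by move=> h hu x xP g gu; rewrite representationV // xP // unitmx_mul gu.
- exact: memvf.
- move=> /(_ 1%:M (unitmx1 _ _)); rewrite rho1 id_lfunE => /(inner_definite ipB).
  by move/eqP: v0n0.
- exact: memvf.
Qed.

Lemma coefficient_right v g h : weight_vector (restriction rho) mu v ->
  g \in unitmx -> h \in unitmx -> upper_triangular h ->
  coef v (g *m GL_embed h) = weight_char mu h * coef v g.
Proof.
move=> wv gu hu ht /=; rewrite -(representationV v rat gu) ?GL_embed_unit //.
by rewrite -[rho (GL_embed h)]/(restriction rho h) wv // linearZ (innerZl ipB).
Qed.

(** Multiplicity at most one: a vector of highest weight [mu] for [GL(n)] is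
    known from the value of its coefficient at one point of the open orbit. *)
Lemma coefficient_base v :
  weight_vector (restriction rho) mu v -> coef v g0 = 0 -> v = 0.
Proof.
move=> wv v_base; apply: coefficient_inj.
apply: (spherical_vanishing (lam := lam) (mu := mu)) v_base.
- exact: coefficient_regular.
- move=> b g bu gu bl; exact: (coefficient_equivariant rat ipB conB wv0).
- by move=> g h gu hu ht; apply: coefficient_right.
Qed.

Lemma weight_vector_interlacing v :
  weight_vector (restriction rho) mu v -> v != 0 -> interlacing lam mu.
Proof.
move=> wv vn0; have base : coef v g0 != 0.
  by apply: contra_neq vn0; apply: coefficient_base.
have freg := coefficient_regular rat ipB v0 v.
have fleft := coefficient_equivariant rat ipB conB wv0 v.
have fright g h := @coefficient_right v g h wv.
move=> i; split.
  exact: (spherical_upper_bound freg fleft fright).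
exact: (spherical_lower_bound freg fleft fright).
Qed.

(** The function [spherical_function] is the coefficient of some vector, which
    inherits the weight of the function under [GL(n)]. *)
Lemma weight_vector_exists : interlacing lam mu ->
  exists2 v, v != 0 & weight_vector (restriction rho) mu v.
Proof.
move=> inter; have [rho1 _ _] := rat.
have [//|b g bu gu bl|v vE] := coefficient_of_equivariant rat ipB conB wv0 v0n0
  (F := spherical_function lam mu).
- exact: spherical_function_regular.
- exact: spherical_function_left.
exists v.
  have := oner_neq0 C; rewrite -(spherical_function_base C lam mu) vE ?last_column_unit //.
  by apply: contra_neq => ->; rewrite linear0 (inner0l ipB).
move=> h hu ht; apply/eqP; rewrite -subr_eq0; apply/eqP/coefficient_inj => g gu.
rewrite linearB linearZ (innerBl ipB) (innerZl ipB) -vE //.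
rewrite /= /restriction representationV ?GL_embed_unit // -vE; last first.
  by rewrite unitmx_mul gu GL_embed_unit.
by rewrite spherical_function_right // subrr.
Qed.

Lemma weight_vector_unique v v' :
  weight_vector (restriction rho) mu v -> weight_vector (restriction rho) mu v' ->
  v' != 0 -> v \in <[v']>%VS.
Proof.
move=> wv wv' v'n0; have base : coef v' g0 != 0.
  by apply: contra_neq v'n0; apply: coefficient_base.
apply/vlineP; exists (coef v g0 / coef v' g0).
apply/eqP; rewrite -subr_eq0; apply/eqP/coefficient_base.
  move=> b bu bt; rewrite linearB linearZ /= wv // wv' // scalerBr !scalerA.
  by rewrite mulrC.
by rewrite linearB linearZ (innerBl ipB) (innerZl ipB) divfK ?subrr.
Qed.

End Branching.

Lemma weight_vector_components (C : fieldType) m (V : vectType C)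
    (sigma : 'M[C]_m -> 'End(V)) mu r (U : 'I_r -> {vspace V}) v :
  irreducible_decomposition sigma U -> weight_vector sigma mu v ->
  exists2 vs : 'I_r -> V, v = \sum_i vs i &
    forall i, vs i \in U i /\ weight_vector sigma mu (vs i).
Proof.
move=> [Udir Ufull Uirr] wv.
have /memv_sumP[vs vsU vE] : v \in (\sum_(i < r) U i)%VS by rewrite Ufull memvf.
exists vs => // i; split; first exact: vsU.
move=> b bu bt; have /directv_sum_unique uniq := Udir.
have := uniq (fun i => sigma b (vs i)) (fun i => weight_char mu b *: vs i).
rewrite -linear_sum -scaler_sumr -vE /= wv // eqxx.
have sU j : predT j -> sigma b (vs j) \in U j.
  by move=> _; have [Uinv _ _] := Uirr j; apply: (subvP (Uinv b bu)); rewrite memv_img ?vsU.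
by move=> /(_ sU (fun j _ => memvZ _ (vsU j isT)))/esym/forall_inP/(_ i isT)/eqP.
Qed.

Lemma isomorphic_weight_vector (C : fieldType) m (V W : vectType C)
    (sigma : 'M[C]_m -> 'End(V)) (tau : 'M[C]_m -> 'End(W)) U mu w0 :
  isomorphic_to_subspace sigma tau U -> weight_vector tau mu w0 -> w0 != 0 ->
  exists u, [/\ u \in U, u != 0 & weight_vector sigma mu u].
Proof.
move=> [f [f0 fU f_eq]] ww w00; exists (f w0); split.
- by rewrite -fU memv_img ?memvf.
- by rewrite -memv_ker f0 memv0.
by move=> b bu bt; rewrite -f_eq // ww // linearZ.
Qed.

(** By the isomorphism criterion, the summands isomorphic to [W] are those
    containing a vector of weight [mu]. Such vectors form at most a line, and a vector on
    it has its components on it too, hence lies in one summand. *)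
Lemma branching_rule (C : numClosedFieldType) n
    (lam : 'I_n.+1 -> int) (mu : 'I_n -> int)
    (V : vectType C) (rho : 'M[C]_n.+1 -> 'End(V))
    (W : vectType C) (tau : 'M[C]_n -> 'End(W)) :
  irreducible_representation rho -> has_highest_weight rho lam ->
  irreducible_representation tau -> has_highest_weight tau mu ->
  (interlacing lam mu -> multiplicity_is (restriction rho) tau 1) /\
  (~ interlacing lam mu -> multiplicity_is (restriction rho) tau 0).
Proof.
move=> [rat irr] [v0 v0n0 wv0] tirr [w0 w00 ww].
have [B ipB conB] := contravariant_inner_product (conj rat irr).
have srat := restriction_rational rat.
have sconB := restriction_contravariant conB.
have decomp := complete_reducibility ipB sconB.
split=> inter; split=> // r U Udec.
  have [v vn0 wv] := weight_vector_exists rat irr ipB conB v0n0 wv0 inter.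
  have unique u u' := @weight_vector_unique _ _ _ _ _ _ _ mu rat irr ipB conB v0n0 wv0 u u'.
  have [vs vE vsP] := weight_vector_components Udec wv.
  have [i vi] : exists i, vs i != 0.
    apply: contrapT => vs0; case/eqP: vn0; rewrite vE big1 // => i _.
    by apply/eqP/negPn/negP => vi; apply: vs0; exists i.
  have [viU wvi] := vsP i; have [Udir _ Uirr] := Udec.
  apply: (@eq_card1 _ i) => j; rewrite !inE; apply/asboolP/eqP => [iso|->].
    have [u [uU un0 wu]] := isomorphic_weight_vector iso ww w00.
    apply: contrapT => /eqP ji; case/eqP: vi.
    have viUj : vs i \in U j.
      by have /vlineP[c ->] := unique _ _ wvi wu un0; rewrite memvZ.
    apply/eqP; rewrite -memv0 -(directv_sumP Udir j isT) memv_cap viUj /=.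
    by apply: (subvP (sumv_sup i _ (subvv _))) viU; rewrite eq_sym.
  exact: (isomorphic_of_weight_vector srat ipB sconB (Uirr i) viU vi wvi tirr w00 ww).
apply: eq_card0 => j; rewrite !inE; apply/asboolP => iso; apply: inter.
have [u [_ un0 wu]] := isomorphic_weight_vector iso ww w00.
exact: (weight_vector_interlacing rat irr ipB conB v0n0 wv0 wu un0).
Qed.

Theorem theorem1 (R : realType) (n : nat) (hn : (1 <= n)%N)
    (lam : 'I_n.+1 -> int) (mu : 'I_n -> int)
    (hlam : dominant lam) (hmu : dominant mu)
    (V : vectType R[i]) (pi_lam : 'M[R[i]]_n.+1 -> 'End(V))
    (hV : irreducible_representation pi_lam)
    (hVlam : has_highest_weight pi_lam lam)
    (W : vectType R[i]) (pi_mu : 'M[R[i]]_n -> 'End(W))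
    (hW : irreducible_representation pi_mu)
    (hWmu : has_highest_weight pi_mu mu) :
  (interlacing lam mu -> multiplicity_is (restriction pi_lam) pi_mu 1) /\
  (~ interlacing lam mu -> multiplicity_is (restriction pi_lam) pi_mu 0).
Proof. exact: branching_rule hV hVlam hW hWmu. Qed.
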